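(* Let $\mathbf{X}=\{X_1,\dots,X_p\}$ and $\mathbf{Y}=\{Y_1,\dots,Y_r\}$ be finite families of irreducible germs of analytic varieties in $(\mathbb{C}^n,0)$, each irredundant (i.e. removing any member of the family changes $\mathbb{D}_{\mathbf{X}}$, resp. $\mathbb{D}_{\mathbf{Y}}$). If $\mathbb{D}_{\mathbf{X}}=\mathbb{D}_{\mathbf{Y}}$, then $\mathbf{X}=\mathbf{Y}$ as sets of germs.
   Context: $\mathcal{O}_n$ denotes the algebra of germs of holomorphic functions $(\mathbb{C}^n,0)\to\mathbb{C}$, and $\mathbb{D}=\operatorname{Der}\mathcal{O}_n$ the Lie algebra of germs of analytic vector fields on $(\mathbb{C}^n,0)$. A ''germ of analytic variety'' means a reduced (possibly reducible) complex space germ $X\subset(\mathbb{C}^n,0)$; $I_X\subset\mathcal{O}_n$ is the ideal of function germs vanishing on $X$, and $\mathbb{D}_X=\{D\in\mathbb{D}: D(I_X)\subset I_X\}$. For a finite family $\mathbf{X}$ of germs, $\mathbb{D}_{\mathbf{X}}=\bigcap_{X\in\mathbf{X}}\mathbb{D}_X$. *)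

(* Defs.v *)
From Stdlib Require Import Reals List.
From Stdlib Require Fin.
From Coquelicot Require Import Coquelicot.
Open Scope R_scope.

Definition Cn (n : nat) : Type := Fin.t n -> C.

Definition polydisc {n : nat} (r : R) (z : Cn n) : Prop :=
  forall i : Fin.t n, Cmod (z i) < r.

Definition near0 {n : nat} (P : Cn n -> Prop) : Prop :=
  exists r : R, 0 < r /\ forall z, polydisc r z -> P z.

Definition upd {n : nat} (z : Cn n) (i : Fin.t n) (w : C) : Cn n :=
  fun j => if Fin.eq_dec i j then w else z j.

Fixpoint fsum (n : nat) : (Fin.t n -> C) -> C :=
  match n with
  | O => fun _ => 0%C
  | S m => fun a => (a Fin.F1 + fsum m (fun i => a (Fin.FS i)))%C
  end.

(* holomorphic on the polydisc of radius r: continuous and complex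
   differentiable in each variable separately (Osgood) *)
Definition holo_on {n : nat} (r : R) (f : Cn n -> C) : Prop :=
  (forall z, polydisc r z ->
     forall eps : R, 0 < eps -> exists delta : R, 0 < delta /\
       forall w : Cn n, (forall i, Cmod (w i - z i) < delta) ->
         Cmod (f w - f z) < eps) /\
  (forall z, polydisc r z -> forall i : Fin.t n,
     exists d : C, @is_derive C_AbsRing C_NormedModule
                     (fun w : C => f (upd z i w)) (z i) d).

Definition holo_germ {n : nat} (f : Cn n -> C) : Prop :=
  exists r : R, 0 < r /\ holo_on r f.

Definition germ_eq {n : nat} (X Y : Cn n -> Prop) : Prop :=
  near0 (fun z => X z <-> Y z).

Definition analytic_germ {n : nat} (X : Cn n -> Prop) : Prop :=
  exists (r : R) (fs : list (Cn n -> C)), 0 < r /\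
    (forall f, In f fs -> holo_on r f) /\
    forall z, polydisc r z -> (X z <-> forall f, In f fs -> f z = 0%C).

Definition irreducible_germ {n : nat} (X : Cn n -> Prop) : Prop :=
  analytic_germ X /\ X (fun _ => 0%C) /\
  forall Y Z : Cn n -> Prop, analytic_germ Y -> analytic_germ Z ->
    germ_eq X (fun z => Y z \/ Z z) -> germ_eq X Y \/ germ_eq X Z.

Definition in_IX {n : nat} (X : Cn n -> Prop) (f : Cn n -> C) : Prop :=
  holo_germ f /\ near0 (fun z => X z -> f z = 0%C).

Definition vfield {n : nat} (a : Fin.t n -> Cn n -> C) : Prop :=
  forall i, holo_germ (a i).

Definition vf_apply_at {n : nat} (a : Fin.t n -> Cn n -> C) (f : Cn n -> C)
    (z : Cn n) (v : C) : Prop :=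
  exists d : Fin.t n -> C,
    (forall i, @is_derive C_AbsRing C_NormedModule
                 (fun w : C => f (upd z i w)) (z i) (d i)) /\
    v = fsum n (fun i => (a i z * d i)%C).

Definition tangent {n : nat} (X : Cn n -> Prop) (a : Fin.t n -> Cn n -> C) : Prop :=
  vfield a /\
  forall f, in_IX X f ->
    exists g, in_IX X g /\
      near0 (fun z => vf_apply_at a f z (g z)).

(* D_X for a finite family Fin.t p -> set germ ; the restriction to the
   members satisfying [keep] models removing members *)
Definition tangent_family {n p : nat} (Xs : Fin.t p -> Cn n -> Prop)
    (keep : Fin.t p -> Prop) (a : Fin.t n -> Cn n -> C) : Prop :=
  vfield a /\ forall k, keep k -> tangent (Xs k) a.

Definition irredundant {n p : nat} (Xs : Fin.t p -> Cn n -> Prop) : Prop :=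
  forall k : Fin.t p,
    ~ (forall a, tangent_family Xs (fun j => j <> k) a <->
                 tangent_family Xs (fun _ => True) a).

(* Main.v *)
Require Import Defs.
From Stdlib Require Import Reals List Lra Lia.
From Stdlib Require Import Classical ClassicalEpsilon FunctionalExtensionality.
From Stdlib Require Fin.
From Coquelicot Require Import Coquelicot.
Open Scope R_scope.
Set Bullet Behavior "Strict Subproofs".

(** Let Z = Y_j and let S be the set of i with Z contained in X_i. Since I_Z is prime, the product h of
    suitable elements of the I_{X_i}, i outside S, is not in I_Z. If a field D is tangent to every X_i with
    i in S, then hD is tangent to all X_i, hence to Z, and cancelling h shows that D is tangent to Z. By
    induction on strict containment, the X_i strictly containing Z already occur among the Y_k. So if Z were
    none of the X_i, then Y_j would be redundant.

    That hD is tangent to X_i for h in I_{X_i} uses that partial derivatives of holomorphic functions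
    are holomorphic. With holomorphy defined by complex differentiability in each variable, this rests on
    Cauchy's integral formula, proved by Goursat's bisection applied to the form f(ζ) dζ / (ζ - z) pulled
    back along the contraction (s, t) -> z + s (rho e^{it} - z) of the circle to z. *)

(** * Complex limits and derivatives *)

(** Only pointwise complex differentiability is given, with no continuity of the derivative, so
    Stokes' theorem cannot be applied directly and the vanishing of integrals over boundaries has to
    be extracted by bisection. In the coordinates (s, t) the form dζ / (ζ - z) is ds / s plus a form
    in t alone, so that affine functions of ζ integrate to zero around every rectangle without any
    logarithm. The pole sits at s = 0: the rectangles stay in e <= s <= 1, and e is made small only
    at the end. This gives Cauchy's formula up to the integral of the kernel over the circle, whose
    value 2π is obtained from the mean value property instead of a winding number. *)

Definition climit {T : Type} (F : (T -> Prop) -> Prop) (f : T -> C) (l : C) : Prop :=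
  forall eps : R, 0 < eps -> F (fun x => Cmod (f x - l) < eps).

Lemma Cmod_sub_sym (a b : C) : Cmod (a - b) = Cmod (b - a).
Proof. rewrite <- Cmod_opp. f_equal. ring. Qed.

Lemma Cmod_le_abs (c : C) : Cmod c <= Rabs (Re c) + Rabs (Im c).
Proof.
destruct c as [x y].
assert (E : (x, y) = (RtoC x + Ci * RtoC y)%C).
{ unfold Cplus, Cmult, Ci, RtoC; simpl. f_equal; ring. }
rewrite E at 1. apply Rle_trans with (1 := Cmod_triangle _ _).
rewrite Cmod_mult, Cmod_Ci, !Cmod_R. unfold Re, Im; simpl. lra.
Qed.

Lemma im_le_Cmod (c : C) : Rabs (Im c) <= Cmod c.
Proof.
apply Rle_trans with (2 := Rmax_Cmod c). apply Rmax_r.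
Qed.

Lemma Cmod_small_eq (a b : C) : (forall eps, 0 < eps -> Cmod (a - b) <= eps) -> a = b.
Proof.
intros H.
assert (E : (a - b = 0)%C).
{ apply Cmod_eq_0. apply Rle_antisym; [|apply Cmod_ge_0].
  apply Rnot_lt_le. intros K. specialize (H (Cmod (a - b) / 2)). lra. }
replace a with ((a - b) + b)%C by ring. rewrite E. ring.
Qed.

Section Climit.
Context {T : Type} (F : (T -> Prop) -> Prop) {FF : Filter F}.

Lemma climit_const (c : C) : climit F (fun _ => c) c.
Proof.
intros eps He. apply filter_forall. intros _.
replace (c - c)%C with (RtoC 0) by ring. now rewrite Cmod_0.
Qed.

Lemma climit_ext_loc (f g : T -> C) (l : C) :
  F (fun x => f x = g x) -> climit F f l -> climit F g l.
Proof.
intros E H eps He. generalize (filter_and _ _ E (H eps He)).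
apply filter_imp. intros x [-> Hx]. exact Hx.
Qed.

Lemma climit_plus (f g : T -> C) (a b : C) :
  climit F f a -> climit F g b -> climit F (fun x => (f x + g x)%C) (a + b)%C.
Proof.
intros Hf Hg eps He.
assert (He2 : 0 < eps / 2) by lra.
generalize (filter_and _ _ (Hf _ He2) (Hg _ He2)).
apply filter_imp. intros x [H1 H2].
replace (f x + g x - (a + b))%C with ((f x - a) + (g x - b))%C by ring.
apply Rle_lt_trans with (1 := Cmod_triangle _ _). lra.
Qed.

Lemma climit_mult (f g : T -> C) (a b : C) :
  climit F f a -> climit F g b -> climit F (fun x => (f x * g x)%C) (a * b)%C.
Proof.
intros Hf Hg eps He.
pose proof (Cmod_ge_0 a) as Ha. pose proof (Cmod_ge_0 b) as Hb.
set (M := Cmod a + Cmod b + 1).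
assert (HM : 0 < M) by (unfold M; lra).
(* The bound 1 makes the quadratic error term at most |g - b|, which the summand 1 of M pays for. *)
assert (Hd : 0 < Rmin 1 (eps / M)).
{ apply Rmin_pos; [lra|]. now apply Rdiv_lt_0_compat. }
generalize (filter_and _ _ (Hf _ Hd) (Hg _ Hd)).
apply filter_imp. intros x [H1 H2].
replace (f x * g x - a * b)%C with ((f x - a) * (g x - b) + (a * (g x - b) + b * (f x - a)))%C by ring.
set (u := (f x - a)%C) in *. set (v := (g x - b)%C) in *.
apply Rle_lt_trans with (Cmod u * Cmod v + (Cmod a * Cmod v + Cmod b * Cmod u)).
{ rewrite <- !Cmod_mult. apply Rle_trans with (1 := Cmod_triangle _ _).
  apply Rplus_le_compat_l. apply Cmod_triangle. }
pose proof (Rmin_l 1 (eps / M)). pose proof (Rmin_r 1 (eps / M)).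
set (d := Rmin 1 (eps / M)) in *.
pose proof (Cmod_ge_0 u). pose proof (Cmod_ge_0 v).
assert (M * d <= eps).
{ apply Rle_trans with (M * (eps / M)); [apply Rmult_le_compat_l; lra|]. right. field. lra. }
assert (Cmod u * Cmod v <= 1 * Cmod v) by (apply Rmult_le_compat_r; lra).
assert (Cmod a * Cmod v <= Cmod a * d) by (apply Rmult_le_compat_l; lra).
assert (Cmod b * Cmod u <= Cmod b * d) by (apply Rmult_le_compat_l; lra).
unfold M in *. lra.
Qed.

Lemma climit_opp (f : T -> C) (a : C) :
  climit F f a -> climit F (fun x => (- f x)%C) (- a)%C.
Proof.
intros H eps He. generalize (H eps He). apply filter_imp. intros x Hx.
replace (- f x - - a)%C with (- (f x - a))%C by ring. now rewrite Cmod_opp.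
Qed.

Lemma climit_minus (f g : T -> C) (a b : C) :
  climit F f a -> climit F g b -> climit F (fun x => (f x - g x)%C) (a - b)%C.
Proof. intros Hf Hg. apply climit_plus; auto. now apply climit_opp. Qed.

Lemma climit_inv (f : T -> C) (a : C) :
  a <> 0%C -> climit F f a -> climit F (fun x => (/ f x)%C) (/ a)%C.
Proof.
intros Ha Hf eps He.
assert (Pa : 0 < Cmod a) by now apply Cmod_gt_0.
(* The first bound keeps |f x| above |a| / 2; the second is what 1 / f - 1 / a = (a - f) / (f a)
   then requires. *)
assert (Hd : 0 < Rmin (Cmod a / 2) (eps * (Cmod a * Cmod a) / 2)).
{ apply Rmin_pos; [lra|]. apply Rdiv_lt_0_compat; [|lra].
  repeat apply Rmult_lt_0_compat; lra. }
generalize (Hf _ Hd). apply filter_imp. intros x Hx.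
pose proof (Rmin_l (Cmod a / 2) (eps * (Cmod a * Cmod a) / 2)).
pose proof (Rmin_r (Cmod a / 2) (eps * (Cmod a * Cmod a) / 2)).
assert (Pf : Cmod a / 2 < Cmod (f x)).
{ pose proof (Cmod_triangle (f x) (a - f x)) as E.
  replace (f x + (a - f x))%C with a in E by ring.
  rewrite (Cmod_sub_sym a) in E. lra. }
assert (Nf : f x <> 0%C) by (apply Cmod_gt_0; lra).
replace (/ f x - / a)%C with ((a - f x) / (f x * a))%C by (field; auto).
rewrite Cmod_div by now apply Cmult_neq_0.
rewrite Cmod_mult, Cmod_sub_sym.
apply Rmult_lt_reg_r with (Cmod (f x) * Cmod a).
{ apply Rmult_lt_0_compat; lra. }
unfold Rdiv. rewrite Rmult_assoc, Rinv_l, Rmult_1_r.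
2:{ apply Rgt_not_eq. apply Rmult_lt_0_compat; lra. }
apply Rlt_le_trans with (eps * (Cmod a * Cmod a) / 2); [lra|].
assert (Cmod a / 2 * Cmod a <= Cmod (f x) * Cmod a) by (apply Rmult_le_compat_r; lra).
assert (eps * (Cmod a / 2 * Cmod a) <= eps * (Cmod (f x) * Cmod a)) by (apply Rmult_le_compat_l; lra).
lra.
Qed.

Lemma climit_re (f : T -> C) (a : C) :
  climit F f a -> filterlim (fun x => Re (f x)) F (locally (Re a)).
Proof.
intros H. apply filterlim_locally. intros eps.
generalize (H eps (cond_pos eps)). apply filter_imp. intros x Hx.
apply Rle_lt_trans with (2 := Hx).
exact (re_le_Cmod (f x - a)).
Qed.

Lemma climit_im (f : T -> C) (a : C) :
  climit F f a -> filterlim (fun x => Im (f x)) F (locally (Im a)).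
Proof.
intros H. apply filterlim_locally. intros eps.
generalize (H eps (cond_pos eps)). apply filter_imp. intros x Hx.
apply Rle_lt_trans with (2 := Hx).
exact (im_le_Cmod (f x - a)).
Qed.

End Climit.

Lemma climit_comp {T U : Type} (F : (T -> Prop) -> Prop) (G : (U -> Prop) -> Prop)
  (h : T -> U) (f : U -> C) (l : C) :
  filterlim h F G -> climit G f l -> climit F (fun x => f (h x)) l.
Proof. intros Hh Hf eps He. exact (Hh _ (Hf eps He)). Qed.

(** Spelling out the balls of the modulus avoids choosing between the product uniform structure on C
    and that of [C_AbsRing]. *)
Definition nbC (x : C) : (C -> Prop) -> Prop :=
  fun P => exists d, 0 < d /\ forall y, Cmod (y - x) < d -> P y.

Global Instance nbC_filter (x : C) : Filter (nbC x).
Proof.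
constructor.
- exists 1. split; [lra|]. auto.
- intros P Q [d [Hd HP]] [e [He HQ]]. exists (Rmin d e).
  split; [now apply Rmin_pos|].
  intros y Hy. pose proof (Rmin_l d e). pose proof (Rmin_r d e).
  split; [apply HP|apply HQ]; lra.
- intros P Q H [d [Hd HP]]. exists d. split; auto.
Qed.

Lemma climit_filterlim {T : Type} (F : (T -> Prop) -> Prop) {FF : Filter F} (f : T -> C) (l : C) :
  climit F f l -> filterlim f F (nbC l).
Proof.
intros H P [d [Hd HP]]. unfold filtermap. generalize (H d Hd). apply filter_imp. auto.
Qed.

Lemma climit_id (x : C) : climit (nbC x) (fun y => y) x.
Proof. intros eps He. exists eps. auto. Qed.

(** The error bound is non-strict and multiplied out: y = x needs no exclusion and no quotient
    appears. *)
Definition has_cderiv (f : C -> C) (x l : C) : Prop :=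
  forall eps, 0 < eps -> nbC x (fun y => Cmod (f y - f x - (y - x) * l) <= eps * Cmod (y - x)).

Lemma is_derive_has_cderiv (f : C -> C) (x l : C) :
  @is_derive C_AbsRing C_NormedModule f x l <-> has_cderiv f x l.
Proof.
split.
- intros [_ H] eps He.
  specialize (H x (fun P HP => HP) (mkposreal eps He)).
  destruct H as [d Hd]. exists d. split; [apply cond_pos|]. intros y Hy.
  exact (Hd y Hy).
- intros H. split; [apply is_linear_scal_l|].
  intros y Hy. apply (@is_filter_lim_locally_unique C_AbsRing (AbsRing_NormedModule C_AbsRing)) in Hy. subst y.
  intros eps. destruct (H eps (cond_pos eps)) as [d [Hd Hd']].
  exists (mkposreal d Hd). intros y Hy. exact (Hd' y Hy).
Qed.

Lemma has_cderiv_unique (f : C -> C) (x l m : C) :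
  has_cderiv f x l -> has_cderiv f x m -> l = m.
Proof.
intros H1 H2. apply Cmod_small_eq. intros eps He.
assert (He2 : 0 < eps / 2) by lra.
destruct (filter_and _ _ (H1 _ He2) (H2 _ He2)) as [d [Hd K]].
(* A real increment inside the disc: one nonzero direction already determines the derivative. *)
set (h := d / 2). assert (0 < h) by (unfold h; lra).
assert (E : Cmod h = h) by (rewrite Cmod_R; apply Rabs_pos_eq; lra).
specialize (K (x + h)%C).
replace (x + h - x)%C with (RtoC h) in K by ring.
rewrite E in K. destruct K as [K1 K2]; [unfold h; lra|].
set (u := (f (x + h)%C - f x)%C) in *.
assert (B : Cmod (RtoC h * (l - m)) <= eps * h).
{ replace (RtoC h * (l - m))%C with ((u - h * m) - (u - h * l))%C by ring.
  apply Rle_trans with (1 := Cmod_triangle _ _). rewrite Cmod_opp. lra. }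
rewrite Cmod_mult, E in B. apply Rmult_le_reg_l with h; auto. lra.
Qed.

(** Carathéodory's form of the derivative: the increment factors as (y - x) phi(y) with phi tending
    to the derivative. Sum and product rules become algebraic identities combined with rules for
    limits. *)
Lemma has_cderiv_slope (f phi : C -> C) (x l : C) :
  climit (nbC x) phi l -> nbC x (fun y => f y - f x = (y - x) * phi y)%C -> has_cderiv f x l.
Proof.
intros H E eps He. generalize (filter_and _ _ (H eps He) E).
apply filter_imp. intros y [Hy ->].
replace ((y - x) * phi y - (y - x) * l)%C with ((phi y - l) * (y - x))%C by ring.
rewrite Cmod_mult. apply Rmult_le_compat_r; [apply Cmod_ge_0|lra].
Qed.

Lemma slope_has_cderiv (f : C -> C) (x l : C) :
  has_cderiv f x l -> exists phi, climit (nbC x) phi l /\ forall y, (f y - f x = (y - x) * phi y)%C.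
Proof.
intros H.
(* The difference quotient, completed by the value l at y = x so that the factorization holds
   everywhere. *)
exists (fun y => if excluded_middle_informative (y = x) then l else ((f y - f x) / (y - x))%C).
split.
- intros eps He. assert (He2 : 0 < eps / 2) by lra.
  generalize (H _ He2). apply filter_imp. intros y Hy.
  destruct (excluded_middle_informative (y = x)) as [->|N].
  + replace (l - l)%C with (RtoC 0) by ring. now rewrite Cmod_0.
  + assert (N' : (y - x <> 0)%C).
    { intros E. apply N. replace y with ((y - x) + x)%C by ring. rewrite E. ring. }
    replace ((f y - f x) / (y - x) - l)%C with ((f y - f x - (y - x) * l) / (y - x))%C by (field; auto).
    rewrite Cmod_div by auto.
    assert (P : 0 < Cmod (y - x)) by now apply Cmod_gt_0.
    apply Rle_lt_trans with (eps / 2); [|lra].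
    apply Rmult_le_reg_r with (Cmod (y - x)); auto.
    unfold Rdiv at 1. rewrite Rmult_assoc, Rinv_l by lra. lra.
- intros y. destruct (excluded_middle_informative (y = x)) as [->|N]; [ring|].
  field. intros E. apply N. replace y with ((y - x) + x)%C by ring. rewrite E. ring.
Qed.

Lemma has_cderiv_climit (f : C -> C) (x l : C) :
  has_cderiv f x l -> climit (nbC x) f (f x).
Proof.
intros H. destruct (slope_has_cderiv _ _ _ H) as [phi [Hp E]].
replace (f x) with (f x + (x - x) * l)%C by ring.
apply climit_ext_loc with (fun y => f x + (y - x) * phi y)%C; [typeclasses eauto| |].
- apply filter_forall. intros y. rewrite <- E. ring.
- apply climit_plus; [typeclasses eauto|apply climit_const; typeclasses eauto|].
  apply climit_mult; auto; [typeclasses eauto|].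
  apply climit_minus; [typeclasses eauto| apply climit_id|apply climit_const; typeclasses eauto].
Qed.

Lemma has_cderiv_ext_loc (f g : C -> C) (x l : C) :
  nbC x (fun y => f y = g y) -> has_cderiv f x l -> has_cderiv g x l.
Proof.
intros E H eps He.
assert (Ex : f x = g x).
{ destruct E as [d [Hd K]]. apply K. replace (x - x)%C with (RtoC 0) by ring. now rewrite Cmod_0. }
generalize (filter_and _ _ E (H eps He)). apply filter_imp. intros y [<- Hy]. now rewrite <- Ex.
Qed.

Lemma has_cderiv_const (c x : C) : has_cderiv (fun _ => c) x 0%C.
Proof.
apply has_cderiv_slope with (fun _ => 0%C).
- apply climit_const; typeclasses eauto.
- apply filter_forall. intros y. ring.
Qed.

Lemma has_cderiv_plus (f g : C -> C) (x l m : C) :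
  has_cderiv f x l -> has_cderiv g x m -> has_cderiv (fun y => f y + g y)%C x (l + m)%C.
Proof.
intros Hf Hg.
destruct (slope_has_cderiv _ _ _ Hf) as [phi [Hp E]].
destruct (slope_has_cderiv _ _ _ Hg) as [psi [Hq E']].
apply has_cderiv_slope with (fun y => phi y + psi y)%C.
- apply climit_plus; auto; typeclasses eauto.
- apply filter_forall. intros y.
  replace (f y + g y - (f x + g x))%C with ((f y - f x) + (g y - g x))%C by ring.
  rewrite E, E'. ring.
Qed.

Lemma has_cderiv_mult (f g : C -> C) (x l m : C) :
  has_cderiv f x l -> has_cderiv g x m ->
  has_cderiv (fun y => f y * g y)%C x (l * g x + f x * m)%C.
Proof.
intros Hf Hg.
destruct (slope_has_cderiv _ _ _ Hf) as [phi [Hp E]].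
destruct (slope_has_cderiv _ _ _ Hg) as [psi [Hq E']].
apply has_cderiv_slope with (fun y => phi y * g y + f x * psi y)%C.
- apply climit_plus; [typeclasses eauto| |]; apply climit_mult; auto; try typeclasses eauto.
  + eapply has_cderiv_climit; eauto.
  + apply climit_const; typeclasses eauto.
- apply filter_forall. intros y.
  replace (f y * g y - f x * g x)%C with ((f y - f x) * g y + f x * (g y - g x))%C by ring.
  rewrite E, E'. ring.
Qed.

(** The affine shape covers both uses: 1 / (ρ e^{it} - x) as a function of the point x, and 1 / (1 -
    b x), the conjugate of the kernel on the circle. *)
Lemma has_cderiv_inv_affine (a b x : C) :
  (a - b * x <> 0)%C ->
  has_cderiv (fun y => / (a - b * y))%C x (b / ((a - b * x) * (a - b * x)))%C.
Proof.
intros N.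
assert (L : climit (nbC x) (fun y => a - b * y)%C (a - b * x)%C).
{ apply climit_minus; [typeclasses eauto|apply climit_const; typeclasses eauto|].
  apply climit_mult; [typeclasses eauto|apply climit_const; typeclasses eauto|apply climit_id]. }
apply has_cderiv_slope with (fun y => b * / ((a - b * y) * (a - b * x)))%C.
- unfold Cdiv. apply climit_mult; [typeclasses eauto|apply climit_const; typeclasses eauto|].
  apply climit_inv; [typeclasses eauto|now apply Cmult_neq_0|].
  apply climit_mult; auto; [typeclasses eauto|apply climit_const; typeclasses eauto].
- assert (P : 0 < Cmod (a - b * x)) by now apply Cmod_gt_0.
  generalize (L _ P). apply filter_imp. intros y Hy.
  assert (N' : (a - b * y <> 0)%C).
  { intros E. rewrite E, Cmod_sub_sym in Hy.
    replace (a - b * x - 0)%C with (a - b * x)%C in Hy by ring. lra. }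
  field. auto.
Qed.

(** * Complex-valued integrals and bisection *)

(** Continuity is two-sided even at the endpoints, which the integrands below satisfy; restriction
    to subintervals is then immediate. *)
Definition ccont_on (f : R -> C) (a b : R) : Prop :=
  forall t, a <= t <= b -> climit (locally t) f (f t).

Definition CInt (f : R -> C) (a b : R) : C :=
  (RInt (fun t => Re (f t)) a b, RInt (fun t => Im (f t)) a b).

Lemma ccont_on_ex_RInt (f : R -> C) (a b : R) :
  a <= b -> ccont_on f a b ->
  ex_RInt (fun t => Re (f t)) a b /\ ex_RInt (fun t => Im (f t)) a b.
Proof.
intros Hab H. split; apply (ex_RInt_continuous (V := R_CompleteNormedModule));
  rewrite Rmin_left, Rmax_right by lra; intros t Ht.
- apply (climit_re (locally t) f (f t)). auto.
- apply (climit_im (locally t) f (f t)). auto.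
Qed.

Lemma ccont_on_sub (f : R -> C) (a b c d : R) :
  a <= c -> d <= b -> ccont_on f a b -> ccont_on f c d.
Proof. intros H1 H2 H t Ht. apply H. lra. Qed.

Lemma CInt_ext (f g : R -> C) (a b : R) :
  a <= b -> (forall t, a <= t <= b -> f t = g t) -> CInt f a b = CInt g a b.
Proof.
intros Hab H. unfold CInt. f_equal; apply RInt_ext; rewrite Rmin_left, Rmax_right by lra;
  intros t Ht; rewrite H; auto; lra.
Qed.

Lemma CInt_plus (f g : R -> C) (a b : R) :
  a <= b -> ccont_on f a b -> ccont_on g a b ->
  CInt (fun t => f t + g t)%C a b = (CInt f a b + CInt g a b)%C.
Proof.
intros Hab Hf Hg.
destruct (ccont_on_ex_RInt f a b Hab Hf), (ccont_on_ex_RInt g a b Hab Hg).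
unfold CInt, Cplus; simpl. f_equal.
- rewrite <- (RInt_plus (V := R_CompleteNormedModule)); auto.
- rewrite <- (RInt_plus (V := R_CompleteNormedModule)); auto.
Qed.

Lemma CInt_scal (c : C) (f : R -> C) (a b : R) :
  a <= b -> ccont_on f a b -> CInt (fun t => c * f t)%C a b = (c * CInt f a b)%C.
Proof.
intros Hab Hf. destruct (ccont_on_ex_RInt f a b Hab Hf) as [H1 H2].
unfold CInt, Cmult; simpl. f_equal.
- rewrite <- (RInt_scal (V := R_CompleteNormedModule) _ a b (fst c)) by auto.
  rewrite <- (RInt_scal (V := R_CompleteNormedModule) _ a b (snd c)) by auto.
  rewrite <- (RInt_minus (V := R_CompleteNormedModule)).
  + apply RInt_ext. reflexivity.
  + now apply (ex_RInt_scal (V := R_CompleteNormedModule)).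
  + now apply (ex_RInt_scal (V := R_CompleteNormedModule)).
- rewrite <- (RInt_scal (V := R_CompleteNormedModule) _ a b (fst c)) by auto.
  rewrite <- (RInt_scal (V := R_CompleteNormedModule) _ a b (snd c)) by auto.
  rewrite <- (RInt_plus (V := R_CompleteNormedModule)).
  + apply RInt_ext. reflexivity.
  + now apply (ex_RInt_scal (V := R_CompleteNormedModule)).
  + now apply (ex_RInt_scal (V := R_CompleteNormedModule)).
Qed.

Lemma CInt_const (c : C) (a b : R) : CInt (fun _ => c) a b = (c * RtoC (b - a))%C.
Proof.
unfold CInt. rewrite !RInt_const. unfold scal; simpl. unfold mult; simpl.
destruct c as [x y]. unfold Cmult, RtoC, Re, Im; simpl. f_equal; ring.
Qed.

Lemma CInt_conj (f : R -> C) (a b : R) :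
  a <= b -> ccont_on f a b -> CInt (fun t => Cconj (f t)) a b = Cconj (CInt f a b).
Proof.
intros Hab Hf. destruct (ccont_on_ex_RInt f a b Hab Hf) as [H1 H2].
unfold CInt, Cconj; simpl. f_equal.
exact (RInt_opp (V := R_CompleteNormedModule) _ _ _ H2).
Qed.

Lemma CInt_Chasles (f : R -> C) (a b c : R) :
  a <= b -> b <= c -> ccont_on f a c -> (CInt f a b + CInt f b c)%C = CInt f a c.
Proof.
intros H1 H2 H.
destruct (ccont_on_ex_RInt f a b H1) as [K1 K2]; [now apply ccont_on_sub with a c; try lra|].
destruct (ccont_on_ex_RInt f b c H2) as [K3 K4]; [now apply ccont_on_sub with a c; try lra|].
unfold CInt, Cplus; simpl. f_equal.
- exact (RInt_Chasles (V := R_CompleteNormedModule) _ _ _ _ K1 K3).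
- exact (RInt_Chasles (V := R_CompleteNormedModule) _ _ _ _ K2 K4).
Qed.

(* The factor 2 comes from estimating real and imaginary parts separately; it is harmless here. *)
Lemma Cmod_CInt_le (f : R -> C) (a b M : R) :
  a <= b -> ccont_on f a b -> (forall t, a <= t <= b -> Cmod (f t) <= M) ->
  Cmod (CInt f a b) <= 2 * M * (b - a).
Proof.
intros Hab Hf HM. destruct (ccont_on_ex_RInt f a b Hab Hf) as [H1 H2].
apply Rle_trans with (1 := Cmod_le_abs _). unfold CInt; simpl.
assert (Rabs (RInt (fun t => Re (f t)) a b) <= (b - a) * M).
{ apply abs_RInt_le_const; auto. intros t Ht. apply Rle_trans with (2 := HM t Ht). apply re_le_Cmod. }
assert (Rabs (RInt (fun t => Im (f t)) a b) <= (b - a) * M).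
{ apply abs_RInt_le_const; auto. intros t Ht. apply Rle_trans with (2 := HM t Ht). apply im_le_Cmod. }
lra.
Qed.

Lemma CInt_minus (f g : R -> C) (a b : R) :
  a <= b -> ccont_on f a b -> ccont_on g a b ->
  CInt (fun t => f t - g t)%C a b = (CInt f a b - CInt g a b)%C.
Proof.
intros Hab Hf Hg.
assert (Hg' : ccont_on (fun t => (- RtoC 1) * g t)%C a b).
{ intros t Ht. apply climit_mult; [typeclasses eauto|apply climit_const; typeclasses eauto|auto]. }
rewrite (CInt_ext (fun t => f t - g t)%C (fun t => f t + (- RtoC 1) * g t)%C) by (auto; intros; ring).
rewrite CInt_plus, CInt_scal; auto. ring.
Qed.

Lemma nested_intervals (l u : nat -> R) :
  (forall n, l n <= l (S n)) -> (forall n, u (S n) <= u n) -> (forall n, l n <= u n) ->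
  exists x, forall n, l n <= x <= u n.
Proof.
intros Hl Hu Hlu.
assert (Ml : forall n m, (n <= m)%nat -> l n <= l m).
{ intros n m. induction 1; [lra|]. apply Rle_trans with (1 := IHle). auto. }
assert (Mu : forall n m, (n <= m)%nat -> u m <= u n).
{ intros n m. induction 1; [lra|]. apply Rle_trans with (2 := IHle). auto. }
assert (Mx : forall n m, l n <= u m).
{ intros n m. apply Rle_trans with (l (Nat.max n m)); [apply Ml; lia|].
  apply Rle_trans with (u (Nat.max n m)); [auto|apply Mu; lia]. }
destruct (completeness (fun x => exists n, x = l n)) as [x [Hx1 Hx2]].
- exists (u O). intros y [n ->]. auto.
- exists (l O), O. reflexivity.
- exists x. intros n. split; [apply Hx1; now exists n|].
  apply Hx2. intros y [m ->]. auto.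
Qed.

(** * Goursat's bisection for an additive function of rectangles *)

Section Bisection.
Variable A : R -> R -> R -> R -> C.

(** One halving in s, then one in t, instead of a choice among four quarters. For additive A, if the
    first half carries less than half of the modulus, the other half carries at least half of it; a
    quarter survives both halvings. *)
Definition rect_step (q : (R * R) * (R * R)) : (R * R) * (R * R) :=
  let '((s1, s2), (t1, t2)) := q in
  let s := (s1 + s2) / 2 in
  let t := (t1 + t2) / 2 in
  let '(s1', s2') :=
    if Rle_dec (Cmod (A s1 s2 t1 t2) / 2) (Cmod (A s1 s t1 t2)) then (s1, s) else (s, s2) in
  let '(t1', t2') :=
    if Rle_dec (Cmod (A s1' s2' t1 t2) / 2) (Cmod (A s1' s2' t1 t)) then (t1, t) else (t, t2) in
  ((s1', s2'), (t1', t2')).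

(** Each step halves both sides and keeps a quarter of the modulus. After n steps the modulus is at
    least |A| / 4^n, while the local bound at the common point of the rectangles gives eps L^2 /
    4^n; the powers cancel and |A| is arbitrarily small. *)
Lemma rect_additive_zero (a b c d : R) :
  a <= b -> c <= d ->
  (forall s1 s2 s3 t1 t2, a <= s1 -> s1 <= s2 -> s2 <= s3 -> s3 <= b -> c <= t1 -> t1 <= t2 -> t2 <= d ->
     A s1 s3 t1 t2 = (A s1 s2 t1 t2 + A s2 s3 t1 t2)%C) ->
  (forall s1 s2 t1 t2 t3, a <= s1 -> s1 <= s2 -> s2 <= b -> c <= t1 -> t1 <= t2 -> t2 <= t3 -> t3 <= d ->
     A s1 s2 t1 t3 = (A s1 s2 t1 t2 + A s1 s2 t2 t3)%C) ->
  (forall s0 t0 eps, a <= s0 <= b -> c <= t0 <= d -> 0 < eps ->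
     exists delta, 0 < delta /\ forall s1 s2 t1 t2,
       a <= s1 -> s1 <= s0 <= s2 -> s2 <= b -> c <= t1 -> t1 <= t0 <= t2 -> t2 <= d ->
       (s2 - s1) + (t2 - t1) < delta ->
       Cmod (A s1 s2 t1 t2) <= eps * ((s2 - s1) + (t2 - t1)) ^ 2) ->
  A a b c d = 0%C.
Proof.
intros Hab Hcd Hs Ht Hloc.
set (q := fix q n := match n with O => ((a, b), (c, d)) | S m => rect_step (q m) end).
set (s1 n := fst (fst (q n))). set (s2 n := snd (fst (q n))).
set (t1 n := fst (snd (q n))). set (t2 n := snd (snd (q n))).
assert (Hq : forall n,
  a <= s1 n /\ s1 n <= s2 n /\ s2 n <= b /\ c <= t1 n /\ t1 n <= t2 n /\ t2 n <= d ->
  s1 n <= s1 (S n) /\ s1 (S n) <= s2 (S n) /\ s2 (S n) <= s2 n /\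
  t1 n <= t1 (S n) /\ t1 (S n) <= t2 (S n) /\ t2 (S n) <= t2 n /\
  s2 (S n) - s1 (S n) = (s2 n - s1 n) / 2 /\ t2 (S n) - t1 (S n) = (t2 n - t1 n) / 2 /\
  Cmod (A (s1 n) (s2 n) (t1 n) (t2 n)) / 4 <= Cmod (A (s1 (S n)) (s2 (S n)) (t1 (S n)) (t2 (S n)))).
{ intros n. unfold s1, s2, t1, t2. simpl q.
  destruct (q n) as [[u v] [x y]]. simpl. intros (H1 & H2 & H3 & H4 & H5 & H6).
  assert (E1 := Hs u ((u + v) / 2) v x y ltac:(lra) ltac:(lra) ltac:(lra) ltac:(lra) ltac:(lra) ltac:(lra) ltac:(lra)).
  assert (T1 := Cmod_triangle (A u ((u + v) / 2) x y) (A ((u + v) / 2) v x y)).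
  rewrite <- E1 in T1.
  destruct (Rle_dec (Cmod (A u v x y) / 2) (Cmod (A u ((u + v) / 2) x y))) as [L1|L1].
  - assert (E2 := Ht u ((u + v) / 2) x ((x + y) / 2) y ltac:(lra) ltac:(lra) ltac:(lra) ltac:(lra) ltac:(lra) ltac:(lra) ltac:(lra)).
    assert (T2 := Cmod_triangle (A u ((u + v) / 2) x ((x + y) / 2)) (A u ((u + v) / 2) ((x + y) / 2) y)).
    rewrite <- E2 in T2.
    destruct (Rle_dec _ _) as [L2|L2]; simpl; repeat split; lra.
  - assert (E2 := Ht ((u + v) / 2) v x ((x + y) / 2) y ltac:(lra) ltac:(lra) ltac:(lra) ltac:(lra) ltac:(lra) ltac:(lra) ltac:(lra)).
    assert (T2 := Cmod_triangle (A ((u + v) / 2) v x ((x + y) / 2)) (A ((u + v) / 2) v ((x + y) / 2) y)).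
    rewrite <- E2 in T2.
    destruct (Rle_dec _ _) as [L2|L2]; simpl; repeat split; lra. }
assert (I : forall n,
  a <= s1 n /\ s1 n <= s2 n /\ s2 n <= b /\ c <= t1 n /\ t1 n <= t2 n /\ t2 n <= d).
{ induction n.
  - unfold s1, s2, t1, t2; simpl. lra.
  - specialize (Hq n IHn). lra. }
set (L := (b - a) + (d - c)).
assert (E : forall n, (s2 n - s1 n) + (t2 n - t1 n) = L / 2 ^ n /\
  Cmod (A a b c d) / 4 ^ n <= Cmod (A (s1 n) (s2 n) (t1 n) (t2 n))).
{ induction n.
  - unfold s1, s2, t1, t2, L; simpl. lra.
  - specialize (Hq n (I n)). destruct IHn as [E1 E2]. split.
    + replace (L / 2 ^ S n) with ((L / 2 ^ n) / 2) by (simpl; field; apply pow_nonzero; lra). lra.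
    + replace (Cmod (A a b c d) / 4 ^ S n) with ((Cmod (A a b c d) / 4 ^ n) / 4)
        by (simpl; field; apply pow_nonzero; lra). lra. }
destruct (nested_intervals s1 s2) as [s0 Hs0].
1-3: intros n; pose proof (Hq n (I n)); pose proof (I n); lra.
destruct (nested_intervals t1 t2) as [t0 Ht0].
1-3: intros n; pose proof (Hq n (I n)); pose proof (I n); lra.
assert (L0 : 0 <= L) by (unfold L; lra).
apply Cmod_small_eq. intros eps He.
replace (A a b c d - 0)%C with (A a b c d) by ring.
(* The + 1 keeps the denominator positive for a degenerate rectangle with L = 0; the same reason
   gives L + 1 below. *)
assert (He' : 0 < eps / (L ^ 2 + 1)).
{ apply Rdiv_lt_0_compat; auto. pose proof (pow2_ge_0 L). lra. }
destruct (Hloc s0 t0 (eps / (L ^ 2 + 1))) as [delta [Hd K]]; auto.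
{ specialize (Hs0 O). specialize (I O). lra. }
{ specialize (Ht0 O). specialize (I O). lra. }
destruct (pow_lt_1_zero (1/2) ltac:(rewrite Rabs_pos_eq; lra) (delta / (L + 1)) ltac:(apply Rdiv_lt_0_compat; lra)) as [N HN].
specialize (HN N (le_n N)). rewrite Rabs_pos_eq in HN by (apply pow_le; lra).
assert (P2 : 0 < 2 ^ N) by (apply pow_lt; lra).
assert (EN : (1 / 2) ^ N = / 2 ^ N) by (unfold Rdiv; rewrite Rmult_1_l; apply pow_inv).
rewrite EN in HN.
destruct (E N) as [E1 E2]. specialize (I N). specialize (Hs0 N). specialize (Ht0 N).
specialize (K (s1 N) (s2 N) (t1 N) (t2 N)).
rewrite E1 in K.
assert (HL : L / 2 ^ N < delta).
{ apply Rle_lt_trans with ((L + 1) * / 2 ^ N).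
  - apply Rmult_le_compat_r; [left; now apply Rinv_0_lt_compat|lra].
  - apply Rlt_le_trans with ((L + 1) * (delta / (L + 1))).
    + apply Rmult_lt_compat_l; lra.
    + right. field. lra. }
assert (B : Cmod (A a b c d) / 4 ^ N <= eps / (L ^ 2 + 1) * (L / 2 ^ N) ^ 2).
{ apply Rle_trans with (1 := E2). apply K; lra. }
assert (P4 : 4 ^ N = 2 ^ N * 2 ^ N) by (rewrite <- Rpow_mult_distr; f_equal; ring).
rewrite P4 in B.
replace (eps / (L ^ 2 + 1) * (L / 2 ^ N) ^ 2) with ((eps / (L ^ 2 + 1) * L ^ 2) / (2 ^ N * 2 ^ N)) in B
  by (field; pose proof (pow2_ge_0 L); split; lra).
apply Rmult_le_reg_r in B; [|apply Rinv_0_lt_compat; now apply Rmult_lt_0_compat].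
apply Rle_trans with (1 := B).
apply Rle_trans with (eps / (L ^ 2 + 1) * (L ^ 2 + 1)).
- apply Rmult_le_compat_l; lra.
- right. field. pose proof (pow2_ge_0 L). lra.
Qed.
End Bisection.

(** * Cauchy's integral formula on a circle *)

Definition cis (t : R) : C := (cos t, sin t).

Lemma Cmod_cis (t : R) : Cmod (cis t) = 1.
Proof.
unfold Cmod, cis; simpl. rewrite !Rmult_1_r, Rplus_comm.
fold (Rsqr (cos t)) (Rsqr (sin t)). rewrite sin2_cos2. apply sqrt_1.
Qed.

Lemma cis_lipschitz (s t : R) : Cmod (cis t - cis s) <= 2 * Rabs (t - s).
Proof.
apply Rle_trans with (1 := Cmod_le_abs _). unfold cis; simpl.
assert (Rabs (cos t - cos s) <= 1 * Rabs (t - s)).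
{ apply (bounded_variation cos (fun x => - sin x)). intros x _. split.
  - apply is_derive_Reals, derivable_pt_lim_cos.
  - rewrite Rabs_Ropp. apply Rabs_le. apply SIN_bound. }
assert (Rabs (sin t - sin s) <= 1 * Rabs (t - s)).
{ apply (bounded_variation sin cos). intros x _. split.
  - apply is_derive_Reals, derivable_pt_lim_sin.
  - apply Rabs_le. apply COS_bound. }
unfold Rminus in *. lra.
Qed.

Lemma climit_cis (t : R) : climit (locally t) cis (cis t).
Proof.
intros eps He. assert (He2 : 0 < eps / 2) by lra.
exists (mkposreal _ He2). intros s Hs. apply Rle_lt_trans with (1 := cis_lipschitz _ _).
assert (H : Rabs (s - t) < eps / 2) by exact Hs. lra.
Qed.

Lemma climit_RtoC (t : R) : climit (locally t) RtoC (RtoC t).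
Proof.
intros eps He. exists (mkposreal _ He). intros s Hs.
rewrite <- RtoC_minus, Cmod_R. exact Hs.
Qed.

Lemma CInt_cis (a b : R) : a <= b -> CInt (fun t => Ci * cis t)%C a b = (cis b - cis a)%C.
Proof.
intros Hab. unfold CInt, cis, Ci, Cminus, Cplus, Copp; simpl. f_equal.
- transitivity (RInt (fun t => - sin t) a b).
  { apply RInt_ext. intros x _. change (0 * cos x - 1 * sin x = - sin x). ring. }
  apply is_RInt_unique. apply (is_RInt_derive (V := R_CompleteNormedModule) cos (fun t => - sin t)).
  + intros x _. apply is_derive_Reals, derivable_pt_lim_cos.
  + intros x _. apply (continuous_opp (V := R_NormedModule)), continuous_sin.
- transitivity (RInt cos a b).
  { apply RInt_ext. intros x _. change (0 * sin x + 1 * cos x = cos x). ring. }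
  apply is_RInt_unique. apply (is_RInt_derive (V := R_CompleteNormedModule) sin cos).
  + intros x _. apply is_derive_Reals, derivable_pt_lim_sin.
  + intros x _. apply continuous_cos.
Qed.

Ltac ft := typeclasses eauto.
Ltac clim :=
  repeat first
    [ assumption
    | apply climit_cis
    | apply climit_RtoC
    | apply climit_const; ft
    | apply climit_plus; [ft| |]
    | apply climit_minus; [ft| |]
    | apply climit_opp; [ft|]
    | apply climit_mult; [ft| |] ].

Section Homotopy.
Variables (rho : R) (z : C).
Hypothesis Hz : Cmod z < rho.

Let w (t : R) : C := (rho * cis t - z)%C.
Let gam (s t : R) : C := (z + s * w t)%C.
(** The logarithmic derivative w' / w: since gam - z = s w(t), it is the coefficient of dt in dζ /
    (ζ - z). *)
Let k (t : R) : C := (Ci * rho * cis t * / w t)%C.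

Lemma circle_rho_pos : 0 < rho.
Proof. apply Rle_lt_trans with (2 := Hz). apply Cmod_ge_0. Qed.
Let Hrho := circle_rho_pos.

Lemma Cmod_rho_cis (t : R) : Cmod (rho * cis t) = rho.
Proof. rewrite Cmod_mult, Cmod_cis, Cmod_R, Rmult_1_r. apply Rabs_pos_eq. lra. Qed.

Lemma circle_sub_lower (t : R) : rho - Cmod z <= Cmod (w t).
Proof.
pose proof (Cmod_triangle (w t) z) as E.
unfold w in *. replace (rho * cis t - z + z)%C with (rho * cis t)%C in E by ring.
rewrite Cmod_rho_cis in E. lra.
Qed.

Lemma circle_sub_neq0 (t : R) : w t <> 0%C.
Proof. apply Cmod_gt_0. pose proof (circle_sub_lower t). lra. Qed.

Lemma circle_sub_upper (t : R) : Cmod (w t) <= 2 * rho.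
Proof.
unfold w. apply Rle_trans with (1 := Cmod_triangle _ _).
rewrite Cmod_opp, Cmod_rho_cis. lra.
Qed.

Let K := rho / (rho - Cmod z).

Lemma kernel_bound (t : R) : Cmod (k t) <= K.
Proof.
unfold k. rewrite Cmod_mult, Cmod_inv by apply circle_sub_neq0.
replace (Ci * rho * cis t)%C with (Ci * (rho * cis t))%C by ring.
rewrite Cmod_mult, Cmod_Ci, Cmod_rho_cis, Rmult_1_l.
apply Rmult_le_compat_l; [lra|]. apply Rinv_le_contravar; [lra|apply circle_sub_lower].
Qed.

Lemma climit_w (t : R) : climit (locally t) w (w t).
Proof. unfold w. clim. Qed.

Lemma climit_k (t : R) : climit (locally t) k (k t).
Proof. unfold k. clim. apply climit_inv; [ft|apply circle_sub_neq0|apply climit_w]. Qed.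

Lemma gam_in_disc (s t : R) : 0 <= s <= 1 -> Cmod (gam s t) <= rho.
Proof.
intros Hs. replace (gam s t) with (RtoC (1 - s) * z + RtoC s * (rho * cis t))%C
 by (unfold gam, w; rewrite RtoC_minus; ring).
apply Rle_trans with (1 := Cmod_triangle _ _).
rewrite !(Cmod_mult (RtoC _)), Cmod_cis, !Cmod_R, !Rabs_pos_eq by lra.
assert ((1 - s) * Cmod z <= (1 - s) * rho) by (apply Rmult_le_compat_l; lra). lra.
Qed.

Lemma gam_lipschitz (s t s0 t0 : R) : 0 <= s0 <= 1 ->
  Cmod (gam s t - gam s0 t0) <= 2 * rho * (Rabs (s - s0) + Rabs (t - t0)).
Proof.
intros Hs. replace (gam s t - gam s0 t0)%C with
 (RtoC (s - s0) * w t + RtoC s0 * (rho * (cis t - cis t0)))%C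
 by (unfold gam, w; rewrite RtoC_minus; ring).
apply Rle_trans with (1 := Cmod_triangle _ _).
rewrite !Cmod_mult, !Cmod_R, (Rabs_pos_eq s0), (Rabs_pos_eq rho) by lra.
assert (Rabs (s - s0) * Cmod (w t) <= Rabs (s - s0) * (2 * rho))
  by (apply Rmult_le_compat_l; [apply Rabs_pos|apply circle_sub_upper]).
assert (s0 * (rho * Cmod (cis t - cis t0)) <= 1 * (rho * (2 * Rabs (t - t0)))).
{ apply Rmult_le_compat; try lra.
  - apply Rmult_le_pos; [lra|apply Cmod_ge_0].
  - apply Rmult_le_compat_l; [lra|apply cis_lipschitz]. }
lra.
Qed.

Definition ccont_disc (h : C -> C) : Prop :=
  forall x, Cmod x <= rho -> climit (nbC x) h (h x).

Lemma ccont_t (h : C -> C) (s a b : R) :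
  ccont_disc h -> 0 <= s <= 1 -> ccont_on (fun t => h (gam s t) * k t)%C a b.
Proof.
intros Hh Hs t _. apply climit_mult; [ft| |apply climit_k].
apply climit_comp with (nbC (gam s t)).
- apply climit_filterlim; [ft|]. unfold gam. clim.
- apply Hh. now apply gam_in_disc.
Qed.

Lemma ccont_s (h : C -> C) (t a b : R) :
  ccont_disc h -> 0 < a -> b <= 1 -> ccont_on (fun s => h (gam s t) * / RtoC s)%C a b.
Proof.
intros Hh Ha Hb s Hs. apply climit_mult; [ft| |].
- apply climit_comp with (nbC (gam s t)).
  + apply climit_filterlim; [ft|]. unfold gam. clim.
  + apply Hh. apply gam_in_disc. lra.
- apply climit_inv; [ft| |apply climit_RtoC].
  intros E. apply RtoC_inj in E. lra.
Qed.

(* Integral of h(ζ) dζ / (ζ - z) along the image of the boundary of a rectangle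
   under gam; there dζ / (ζ - z) = ds / s + k(t) dt. *)
Definition rect_int (h : C -> C) (s1 s2 t1 t2 : R) : C :=
  (CInt (fun t => h (gam s2 t) * k t) t1 t2 - CInt (fun t => h (gam s1 t) * k t) t1 t2 -
   (CInt (fun s => h (gam s t2) * / RtoC s) s1 s2 - CInt (fun s => h (gam s t1) * / RtoC s) s1 s2))%C.

Lemma rect_int_plus (f h : C -> C) (s1 s2 t1 t2 : R) :
  ccont_disc f -> ccont_disc h -> 0 < s1 -> s1 <= s2 -> s2 <= 1 -> t1 <= t2 ->
  rect_int (fun x => f x + h x)%C s1 s2 t1 t2 =
  (rect_int f s1 s2 t1 t2 + rect_int h s1 s2 t1 t2)%C.
Proof.
intros Hf Hh H1 H2 H3 H4. unfold rect_int.
rewrite (CInt_ext (fun t => (f (gam s2 t) + h (gam s2 t)) * k t)%C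
  (fun t => f (gam s2 t) * k t + h (gam s2 t) * k t)%C) by (auto; intros; ring).
rewrite (CInt_ext (fun t => (f (gam s1 t) + h (gam s1 t)) * k t)%C
  (fun t => f (gam s1 t) * k t + h (gam s1 t) * k t)%C) by (auto; intros; ring).
rewrite (CInt_ext (fun s => (f (gam s t2) + h (gam s t2)) * / RtoC s)%C
  (fun s => f (gam s t2) * / RtoC s + h (gam s t2) * / RtoC s)%C) by (auto; intros; ring).
rewrite (CInt_ext (fun s => (f (gam s t1) + h (gam s t1)) * / RtoC s)%C
  (fun s => f (gam s t1) * / RtoC s + h (gam s t1) * / RtoC s)%C) by (auto; intros; ring).
rewrite !CInt_plus; auto; try (apply ccont_t; auto; lra); try (apply ccont_s; auto; lra).
ring.
Qed.

(** For h = c0 + c1 (ζ - z) the form h dζ / (ζ - z) is c0 ds / s + c0 k(t) dt + c1 d(s w(t)): two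
    terms in one variable each and an exact one. Each integrates to zero around a rectangle. *)
Lemma rect_int_affine (c0 c1 : C) (s1 s2 t1 t2 : R) :
  0 < s1 -> s1 <= s2 -> s2 <= 1 -> t1 <= t2 ->
  rect_int (fun x => c0 + c1 * (x - z))%C s1 s2 t1 t2 = 0%C.
Proof.
intros H1 H2 H3 H4. unfold rect_int.
assert (Ck : ccont_on k t1 t2) by (intros t _; apply climit_k).
assert (Cc : ccont_on (fun t => Ci * cis t)%C t1 t2) by (intros t _; clim).
assert (Ci' : ccont_on (fun s => / RtoC s)%C s1 s2).
{ intros s Hs. apply climit_inv; [ft| |apply climit_RtoC]. intros E. apply RtoC_inj in E. lra. }
assert (Et : forall s, CInt (fun t => (c0 + c1 * (gam s t - z)) * k t)%C t1 t2 =
  (c0 * CInt k t1 t2 + c1 * s * rho * (cis t2 - cis t1))%C).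
{ intros s. rewrite (CInt_ext _ (fun t => c0 * k t + (c1 * s * rho) * (Ci * cis t))%C); auto.
  - rewrite CInt_plus, (CInt_scal c0 k), (CInt_scal _ (fun t => Ci * cis t)%C), CInt_cis; auto.
    + intros t Ht. apply climit_mult; [ft|apply climit_const; ft|apply climit_k].
    + intros t Ht; clim.
  - intros t _. unfold gam, k. field. apply circle_sub_neq0. }
assert (Es : forall t, CInt (fun s => (c0 + c1 * (gam s t - z)) * / RtoC s)%C s1 s2 =
  (c0 * CInt (fun s => / RtoC s)%C s1 s2 + c1 * w t * RtoC (s2 - s1))%C).
{ intros t. rewrite (CInt_ext _ (fun s => c0 * / RtoC s + c1 * w t)%C); auto.
  - rewrite CInt_plus, CInt_scal, CInt_const; auto.
    + intros s Hs; clim. now apply Ci'.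
    + intros s Hs; clim.
  - intros s Hs. unfold gam. field. intros E. apply RtoC_inj in E. lra. }
rewrite !Et, !Es. unfold w. rewrite RtoC_minus. ring.
Qed.

Variable g : C -> C.
Hypothesis Hg : forall x, Cmod x <= rho -> exists l, has_cderiv g x l.

Lemma differentiable_ccont_disc : ccont_disc g.
Proof. intros x Hx. destruct (Hg x Hx) as [l Hl]. eapply has_cderiv_climit; eauto. Qed.

(** Differentiability at x0 = gam s0 t0 leaves an affine function, whose integral is zero, and a
    remainder bounded by a small multiple of |ζ - x0|, hence of the sum of the sides since gam is
    Lipschitz. The length of the boundary is of the same order, whence the square. *)
Lemma rect_int_local (e s0 t0 eps : R) : 0 < e -> e <= s0 <= 1 -> 0 < eps ->
  exists delta, 0 < delta /\ forall s1 s2 t1 t2,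
    e <= s1 -> s1 <= s0 <= s2 -> s2 <= 1 -> t1 <= t0 <= t2 -> (s2 - s1) + (t2 - t1) < delta ->
    Cmod (rect_int g s1 s2 t1 t2) <= eps * ((s2 - s1) + (t2 - t1)) ^ 2.
Proof.
intros He Hs0 Heps.
assert (HK : 0 < K) by (apply Rdiv_lt_0_compat; lra).
assert (Hie : 0 < / e) by now apply Rinv_0_lt_compat.
set (x0 := gam s0 t0).
destruct (Hg x0) as [l Hl]; [apply gam_in_disc; lra|].
(* 8 ρ collects the factor 2 of [Cmod_CInt_le], the two sides of each kind and the Lipschitz
   constant 2 ρ of gam; K and 1 / e bound k(t) and 1 / s. *)
set (B := 8 * rho * (K + / e)).
assert (HB : 0 < B) by (unfold B; apply Rmult_lt_0_compat; lra).
assert (Heta : 0 < eps / B) by now apply Rdiv_lt_0_compat.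
destruct (Hl _ Heta) as [d [Hd Hd']].
exists (d / (2 * rho)). split; [apply Rdiv_lt_0_compat; lra|].
intros s1 s2 t1 t2 H1 H2 H3 H4 Hsig.
set (sig := (s2 - s1) + (t2 - t1)) in *.
set (Rm := fun x => (g x - g x0 - (x - x0) * l)%C).
assert (Cg := differentiable_ccont_disc).
assert (CR : ccont_disc Rm).
{ intros x Hx. unfold Rm. clim; [now apply Cg|apply climit_id]. }
assert (CA : ccont_disc (fun x => (g x0 - (x0 - z) * l) + l * (x - z))%C).
{ intros x Hx. clim. apply climit_id. }
assert (E : rect_int g s1 s2 t1 t2 = rect_int Rm s1 s2 t1 t2).
(* The affine part is written around z instead of x0, the centre used by [rect_int_affine]. *)
{ replace g with (fun x => ((g x0 - (x0 - z) * l) + l * (x - z)) + Rm x)%C at 1.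
  2:{ apply functional_extensionality. intros x. unfold Rm. ring. }
  rewrite rect_int_plus by (auto; lra).
  rewrite rect_int_affine by lra. ring. }
rewrite E.
assert (BR : forall s t, s1 <= s <= s2 -> t1 <= t <= t2 ->
  Cmod (Rm (gam s t)) <= eps / B * (2 * rho * sig)).
{ intros s t Hs Ht.
  assert (G : Cmod (gam s t - x0) <= 2 * rho * sig).
  { apply Rle_trans with (1 := gam_lipschitz s t s0 t0 ltac:(lra)).
    apply Rmult_le_compat_l; [lra|]. unfold sig.
    apply Rplus_le_compat; apply Rabs_le; lra. }
  apply Rle_trans with (eps / B * Cmod (gam s t - x0)).
  - apply Hd'. apply Rle_lt_trans with (1 := G).
    apply Rlt_le_trans with (2 * rho * (d / (2 * rho))).
    + apply Rmult_lt_compat_l; lra.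
    + right. field. lra.
  - apply Rmult_le_compat_l; lra. }
set (M := eps / B * (2 * rho * sig)) in *.
assert (HM : 0 <= M).
{ apply Rle_trans with (2 := BR s0 t0 ltac:(lra) ltac:(lra)). apply Cmod_ge_0. }
assert (Bt : forall s, s1 <= s <= s2 -> Cmod (CInt (fun t => Rm (gam s t) * k t)%C t1 t2) <= 2 * (M * K) * (t2 - t1)).
{ intros s Hs. apply Cmod_CInt_le; [lra|apply ccont_t; auto; lra|].
  intros t Ht. rewrite Cmod_mult. apply Rmult_le_compat; try apply Cmod_ge_0; auto. apply kernel_bound. }
assert (Bs : forall t, t1 <= t <= t2 -> Cmod (CInt (fun s => Rm (gam s t) * / RtoC s)%C s1 s2) <= 2 * (M * / e) * (s2 - s1)).
{ intros t Ht. apply Cmod_CInt_le; [lra|apply ccont_s; auto; lra|].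
  intros s Hs. rewrite Cmod_mult. apply Rmult_le_compat; try apply Cmod_ge_0; auto.
  rewrite Cmod_inv, Cmod_R, Rabs_pos_eq by (try (intros E0; apply RtoC_inj in E0); lra).
  apply Rinv_le_contravar; lra. }
unfold rect_int.
assert (T : forall a b c d : C, Cmod (a - b - (c - d)) <= Cmod a + Cmod b + Cmod c + Cmod d).
{ intros a b c d'. pose proof (Cmod_triangle (a - b) (- (c - d'))).
  pose proof (Cmod_triangle a (- b)). pose proof (Cmod_triangle c (- d')).
  rewrite !Cmod_opp in *. unfold Cminus in *. lra. }
apply Rle_trans with (1 := T _ _ _ _).
pose proof (Bt s1 ltac:(lra)). pose proof (Bt s2 ltac:(lra)).
pose proof (Bs t1 ltac:(lra)). pose proof (Bs t2 ltac:(lra)).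
assert (E2 : eps * sig ^ 2 = 4 * (M * K) * sig + 4 * (M * / e) * sig).
{ unfold M, B. field. repeat split; try lra.
  apply Rgt_not_eq. assert (0 < K * e) by (apply Rmult_lt_0_compat; lra). lra. }
rewrite E2.
assert (0 <= M * K) by (apply Rmult_le_pos; lra).
assert (0 <= M * / e) by (apply Rmult_le_pos; lra).
assert (M * K * (t2 - t1) <= M * K * sig) by (apply Rmult_le_compat_l; unfold sig; lra).
assert (M * / e * (s2 - s1) <= M * / e * sig) by (apply Rmult_le_compat_l; unfold sig; lra).
lra.
Qed.

Lemma rect_int_zero (e c d : R) : 0 < e <= 1 -> c <= d -> rect_int g e 1 c d = 0%C.
Proof.
intros He Hcd. assert (Cg := differentiable_ccont_disc).
apply rect_additive_zero; try lra.
- intros s1 s2 s3 t1 t2 H1 H2 H3 H4 H5 H6 H7. unfold rect_int.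
  rewrite <- (CInt_Chasles (fun s => g (gam s t2) * / RtoC s)%C s1 s2 s3) by (auto; apply ccont_s; auto; lra).
  rewrite <- (CInt_Chasles (fun s => g (gam s t1) * / RtoC s)%C s1 s2 s3) by (auto; apply ccont_s; auto; lra).
  ring.
- intros s1 s2 t1 t2 t3 H1 H2 H3 H4 H5 H6 H7. unfold rect_int.
  rewrite <- (CInt_Chasles (fun t => g (gam s2 t) * k t)%C t1 t2 t3) by (auto; apply ccont_t; auto; lra).
  rewrite <- (CInt_Chasles (fun t => g (gam s1 t) * k t)%C t1 t2 t3) by (auto; apply ccont_t; auto; lra).
  ring.
- intros s0 t0 eps H1 H2 H3.
  destruct (rect_int_local e s0 t0 eps) as [delta [Hd Hl]]; auto; try lra.
  exists delta. split; auto.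
Qed.

(** The sides t = 0 and t = 2π have the same image, so their integrals cancel and the integral over
    the curve of constant s does not depend on s. As s tends to 0 the curve shrinks to z, and by
    continuity g may be replaced by g(z). *)
Lemma cauchy_circle_k :
  CInt (fun t => g (rho * cis t) * k t)%C 0 (2 * PI) = (g z * CInt k 0 (2 * PI))%C.
Proof.
assert (Cg := differentiable_ccont_disc).
assert (HPI := PI_RGT_0).
assert (HK : 0 < K) by (apply Rdiv_lt_0_compat; lra).
set (Phi := fun s => CInt (fun t => g (gam s t) * k t)%C 0 (2 * PI)).
assert (E : forall e, 0 < e <= 1 -> Phi 1 = Phi e).
{ intros e He. pose proof (rect_int_zero e 0 (2 * PI) He ltac:(lra)) as H.
  unfold rect_int in H. fold (Phi 1) (Phi e) in H.
  assert (P : cis (2 * PI) = cis 0) by (unfold cis; now rewrite cos_2PI, sin_2PI, cos_0, sin_0).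
  assert (P' : (fun s => g (gam s (2 * PI)) * / RtoC s)%C = (fun s => g (gam s 0) * / RtoC s)%C).
  { unfold gam, w. now rewrite P. }
  rewrite P' in H.
  replace (Phi 1) with ((Phi 1 - Phi e) + Phi e)%C by ring.
  match goal with |- ?a = ?b => replace a with ((Phi 1 - Phi e -
   (CInt (fun s : R => g (gam s 0) * / s) e 1 - CInt (fun s : R => g (gam s 0) * / s) e 1)) + Phi e)%C by ring end.
  rewrite H. ring. }
replace (CInt _ 0 (2 * PI)) with (Phi 1) at 1.
2:{ unfold Phi. apply CInt_ext; [lra|]. intros t _. do 2 f_equal. unfold gam, w. ring. }
rewrite <- CInt_scal; [|lra|intros t _; apply climit_k].
apply Cmod_small_eq. intros eps Heps.
(* 4 π K is the length 2π of the interval times the bound K of the kernel times the factor 2 of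
   [Cmod_CInt_le]. *)
assert (Heta : 0 < eps / (4 * PI * K)) by (apply Rdiv_lt_0_compat; [lra|apply Rmult_lt_0_compat; [lra|exact HK]]).
assert (Hz' : Cmod z <= rho) by lra.
destruct (Cg z Hz' _ Heta) as [d [Hd Hd']].
(* The points gam e t are then within 2 ρ e <= d / 2 of z. *)
set (e := Rmin 1 (d / (4 * rho))).
assert (He : 0 < e) by (apply Rmin_pos; [lra|apply Rdiv_lt_0_compat; lra]).
assert (He1 : e <= 1) by apply Rmin_l.
assert (He2 : e <= d / (4 * rho)) by apply Rmin_r.
rewrite (E e) by lra. unfold Phi.
rewrite <- CInt_minus; [|lra|apply ccont_t; auto; lra|].
2:{ intros t _. apply climit_mult; [ft|apply climit_const; ft|apply climit_k]. }
apply Rle_trans with (2 * (eps / (4 * PI * K) * K) * (2 * PI - 0)).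
- apply Cmod_CInt_le; [lra| |].
  + intros t Ht. apply climit_minus; [ft| |].
    * apply (ccont_t g e 0 (2 * PI)); auto; lra.
    * apply climit_mult; [ft|apply climit_const; ft|apply climit_k].
  + intros t Ht. replace (g (gam e t) * k t - g z * k t)%C with ((g (gam e t) - g z) * k t)%C by ring.
    rewrite Cmod_mult. apply Rmult_le_compat; try apply Cmod_ge_0; [|apply kernel_bound].
    left. apply Hd'. unfold gam. replace (z + e * w t - z)%C with (RtoC e * w t)%C by ring.
    rewrite Cmod_mult, Cmod_R, Rabs_pos_eq by lra.
    apply Rle_lt_trans with (d / (4 * rho) * (2 * rho)).
    * apply Rmult_le_compat; try lra; [apply Cmod_ge_0|apply circle_sub_upper].
    * replace (d / (4 * rho) * (2 * rho)) with (d / 2) by (field; lra). lra.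
- right. field. split; lra.
Qed.

End Homotopy.

(** Both sides of [cauchy_circle_k] carry the factor i of dζ = i ζ dt. Without it the kernel is ζ /
    (ζ - z), which is identically 1 for z = 0. *)
Lemma cauchy_circle (rho : R) (z : C) (g : C -> C) :
  Cmod z < rho -> (forall x, Cmod x <= rho -> exists l, has_cderiv g x l) ->
  CInt (fun t => g (rho * cis t) * (rho * cis t * / (rho * cis t - z)))%C 0 (2 * PI) =
  (g z * CInt (fun t => rho * cis t * / (rho * cis t - z))%C 0 (2 * PI))%C.
Proof.
intros Hz Hg. assert (HPI := PI_RGT_0).
pose proof (cauchy_circle_k rho z Hz g Hg) as H.
assert (C1 : forall t, climit (locally t) (fun t => rho * cis t * / (rho * cis t - z))%C
   (rho * cis t * / (rho * cis t - z))%C).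
{ intros t. clim. apply climit_inv; [ft|now apply circle_sub_neq0|clim]. }
rewrite (CInt_ext _ (fun t => Ci * (g (rho * cis t) * (rho * cis t * / (rho * cis t - z))))%C) in H
  by (try lra; intros; ring).
rewrite (CInt_ext (fun t => Ci * rho * cis t * / (rho * cis t - z))%C (fun t => Ci * (rho * cis t * / (rho * cis t - z)))%C) in H
  by (try lra; intros; ring).
rewrite !CInt_scal in H; try lra.
- assert (N : Ci <> 0%C) by (intros E; injection E; lra).
  match type of H with (Ci * ?a = ?b * (Ci * ?c))%C =>
    replace a with (/ Ci * (Ci * a))%C by (field; auto); rewrite H; field; auto end.
- intros t _; apply C1.
- intros t _. apply climit_mult; [ft| |apply C1].
  apply climit_comp with (nbC (rho * cis t)%C).
  + apply climit_filterlim; [ft|clim].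
  + destruct (Hg (rho * cis t)%C) as [l Hl]; [rewrite (Cmod_rho_cis rho z Hz); lra|].
    eapply has_cderiv_climit; eauto.
Qed.

(** At the centre the kernel is constant and its integral needs no computation; this special case
    supplies the value of the kernel integral for every other z. *)
Lemma circle_mean_value (rho : R) (g : C -> C) :
  0 < rho -> (forall x, Cmod x <= rho -> exists l, has_cderiv g x l) ->
  CInt (fun t => g (rho * cis t))%C 0 (2 * PI) = (g 0 * RtoC (2 * PI))%C.
Proof.
intros Hr Hg. assert (HPI := PI_RGT_0).
assert (H0 : Cmod 0 < rho) by now rewrite Cmod_0.
assert (E : forall t, (rho * cis t * / (rho * cis t - 0) = 1)%C).
{ intros t. assert (N := circle_sub_neq0 rho 0 H0 t). field.
  split; intros E; apply N; rewrite E; ring. }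
pose proof (cauchy_circle rho 0 g H0 Hg) as H.
rewrite (CInt_ext (fun t => rho * cis t * / (rho * cis t - 0))%C (fun _ => 1%C)), CInt_const in H by (try lra; auto).
rewrite (CInt_ext _ (fun t => g (rho * cis t))%C) in H.
2: lra. 2:{ intros t _. rewrite E. ring. }
rewrite H. rewrite Rminus_0_r. ring.
Qed.

(* On the circle the conjugate of the kernel is 1 / (1 - conj z ζ / rho^2), which is holomorphic
   on the closed disc, so the mean value property evaluates its integral. *)
Lemma circle_kernel_integral (rho : R) (z : C) : Cmod z < rho ->
  CInt (fun t => rho * cis t * / (rho * cis t - z))%C 0 (2 * PI) = RtoC (2 * PI).
Proof.
intros Hz. assert (HPI := PI_RGT_0). assert (Hr := circle_rho_pos rho z Hz).
set (b := (Cconj z * / (rho * rho))%C).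
assert (Nr : RtoC rho <> 0%C) by (intros E; apply RtoC_inj in E; lra).
assert (Nx : forall x, Cmod x <= rho -> (1 - b * x <> 0)%C).
{ intros x Hx E. assert (F : Cmod (b * x) = 1).
  { replace (b * x)%C with (1 - (1 - b * x))%C by ring. rewrite E.
    replace (1 - 0)%C with (RtoC 1) by ring. apply Cmod_1. }
  unfold b in F. rewrite !Cmod_mult, Cmod_conj, Cmod_inv, Cmod_mult, !Cmod_R, Rabs_pos_eq in F
    by (try apply Cmult_neq_0; auto; lra).
  assert (Cmod z * / (rho * rho) * Cmod x <= Cmod z * / (rho * rho) * rho).
  { apply Rmult_le_compat_l; auto. apply Rmult_le_pos; [apply Cmod_ge_0|].
    left; apply Rinv_0_lt_compat. apply Rmult_lt_0_compat; lra. }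
  assert (Cmod z * / (rho * rho) * rho < 1).
  { replace (Cmod z * / (rho * rho) * rho) with (Cmod z / rho) by (field; lra).
    apply Rmult_lt_reg_r with rho; auto. unfold Rdiv. rewrite Rmult_assoc, Rinv_l; lra. }
  lra. }
assert (H := circle_mean_value rho (fun x => / (1 - b * x))%C Hr).
assert (Cc : forall t, Cconj (rho * cis t * / (rho * cis t - z)) = (/ (1 - b * (rho * cis t)))%C).
{ intros t.
  assert (N1 := circle_sub_neq0 rho z Hz t).
  assert (N2 : (1 - b * (rho * cis t) <> 0)%C) by (apply Nx; rewrite (Cmod_rho_cis rho z Hz); lra).
  assert (U : (cis t * Cconj (cis t) = 1)%C).
  { rewrite <- Cmod2_conj, Cmod_cis. now rewrite pow1. }
  assert (N3 : (Cconj (rho * cis t - z) <> 0)%C).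
  { intros E. apply N1. rewrite <- (Cconj_conj (rho * cis t - z)), E. unfold Cconj, RtoC; simpl. f_equal; ring. }
  assert (R1 : forall x : R, Cconj x = x) by (intros x; unfold Cconj, RtoC; simpl; f_equal; ring).
  rewrite !Cmult_conj, Cinv_conj by auto.
  assert (D : Cconj (rho * cis t - z) = (rho * Cconj (cis t) - Cconj z)%C) by now rewrite Cminus_conj, Cmult_conj, R1.
  rewrite D in *. rewrite R1.
  assert (S : ((rho * Cconj (cis t)) * (1 - b * (rho * cis t)) = rho * Cconj (cis t) - Cconj z)%C).
  { unfold b. transitivity (rho * Cconj (cis t) - Cconj z * (cis t * Cconj (cis t)))%C; [field; auto|].
    rewrite U. ring. }
  rewrite <- S. rewrite <- S in N3. field. repeat split; auto; intros E; apply N3; rewrite E; ring. }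
rewrite <- (Cconj_conj (CInt _ _ _)), <- CInt_conj; [|lra|].
2:{ intros t _. clim. apply climit_inv; [ft|now apply circle_sub_neq0|clim]. }
rewrite (CInt_ext _ (fun t => / (1 - b * (rho * cis t)))%C) by (try lra; auto).
rewrite H.
- replace (/ (1 - b * 0))%C with (RtoC 1) by (field; intros E; injection E; lra).
  unfold Cconj, Cmult, RtoC; simpl. f_equal; ring.
- intros x Hx. eexists. apply has_cderiv_inv_affine. auto.
Qed.

Lemma cauchy_integral_formula (rho : R) (z : C) (g : C -> C) :
  Cmod z < rho -> (forall x, Cmod x <= rho -> exists l, has_cderiv g x l) ->
  g z = (/ RtoC (2 * PI) * CInt (fun t => g (rho * cis t) * (rho * cis t * / (rho * cis t - z))) 0 (2 * PI))%C.
Proof.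
intros Hz Hg. rewrite cauchy_circle, circle_kernel_integral by auto.
field. assert (HPI := PI_RGT_0). intros E. apply RtoC_inj in E. lra.
Qed.

(** * Partial derivatives of holomorphic germs *)

Lemma has_cderiv_along_line (f : C -> C) (x h l : C) (s : R) :
  has_cderiv f (x + s * h)%C l ->
  is_derive (fun s : R => Re (f (x + s * h)%C)) s (Re (l * h)%C) /\
  is_derive (fun s : R => Im (f (x + s * h)%C)) s (Im (l * h)%C).
Proof.
intros H.
assert (K : forall eps, 0 < eps -> locally s (fun u : R =>
  Cmod (f (x + u * h) - f (x + s * h) - RtoC (u - s) * (l * h))%C <= eps * Rabs (u - s))).
{ intros eps He. pose proof (Cmod_ge_0 h) as Hh.
  assert (He' : 0 < eps / (Cmod h + 1)) by (apply Rdiv_lt_0_compat; lra).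
  destruct (H _ He') as [d [Hd Hd']].
  assert (Hd2 : 0 < d / (Cmod h + 1)) by (apply Rdiv_lt_0_compat; lra).
  exists (mkposreal _ Hd2). intros u Hu.
  assert (Hu' : Rabs (u - s) < d / (Cmod h + 1)) by exact Hu.
  assert (E : ((x + u * h) - (x + s * h) = RtoC (u - s) * h)%C) by (rewrite RtoC_minus; ring).
  specialize (Hd' (x + u * h)%C). rewrite E in Hd'.
  assert (Eh : Cmod (RtoC (u - s) * h) = Rabs (u - s) * Cmod h) by now rewrite Cmod_mult, Cmod_R.
  rewrite Eh in Hd'.
  replace (RtoC (u - s) * (l * h))%C with (RtoC (u - s) * h * l)%C by ring.
  pose proof (Rabs_pos (u - s)).
  apply Rle_trans with (eps / (Cmod h + 1) * (Rabs (u - s) * Cmod h)).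
  - apply Hd'. apply Rle_lt_trans with (Rabs (u - s) * (Cmod h + 1)).
    + apply Rmult_le_compat_l; lra.
    + apply Rlt_le_trans with (d / (Cmod h + 1) * (Cmod h + 1)).
      * apply Rmult_lt_compat_r; lra.
      * right. field. lra.
  - apply Rle_trans with (eps / (Cmod h + 1) * (Rabs (u - s) * (Cmod h + 1))).
    + apply Rmult_le_compat_l; [lra|]. apply Rmult_le_compat_l; lra.
    + right. field. lra. }
split.
- split; [apply (is_linear_scal_l (K := R_AbsRing) (V := R_NormedModule))|].
  intros y Hy. apply (@is_filter_lim_locally_unique R_AbsRing R_NormedModule) in Hy. subst y.
  intros eps. generalize (K eps (cond_pos eps)). apply filter_imp. refine (fun (u : R) Hu => _).
  apply Rle_trans with (2 := Hu).
  apply Rle_trans with (2 := re_le_Cmod _). right.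
  unfold norm, minus, plus, opp, scal; simpl. unfold abs, mult, Re, Im; simpl. f_equal. ring.
- split; [apply (is_linear_scal_l (K := R_AbsRing) (V := R_NormedModule))|].
  intros y Hy. apply (@is_filter_lim_locally_unique R_AbsRing R_NormedModule) in Hy. subst y.
  intros eps. generalize (K eps (cond_pos eps)). apply filter_imp. refine (fun (u : R) Hu => _).
  apply Rle_trans with (2 := Hu).
  apply Rle_trans with (2 := im_le_Cmod _). right.
  unfold norm, minus, plus, opp, scal; simpl. unfold abs, mult, Re, Im; simpl. f_equal. ring.
Qed.

(** The mean value equality fails for complex values, so the real inequality is applied to each
    component along the segment, hence the factor 2. The bounds are assumed on the whole disc about
    x because [bounded_variation] works on an interval symmetric about its base point. *)
Lemma has_cderiv_increment_le (f df : C -> C) (x y : C) (M : R) :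
  (forall u, Cmod (u - x) <= Cmod (y - x) -> has_cderiv f u (df u) /\ Cmod (df u) <= M) ->
  Cmod (f y - f x) <= 2 * M * Cmod (y - x).
Proof.
intros H. set (h := (y - x)%C).
assert (Hs : forall s : R, Rabs s <= 1 ->
  has_cderiv f (x + s * h)%C (df (x + s * h)%C) /\ Cmod (df (x + s * h)%C * h) <= M * Cmod h).
{ intros s Hs.
  destruct (H (x + s * h)%C) as [H1 H2].
  - replace (x + s * h - x)%C with (RtoC s * h)%C by ring.
    rewrite Cmod_mult, Cmod_R. fold h.
    apply Rle_trans with (1 * Cmod h); [|lra].
    apply Rmult_le_compat_r; [apply Cmod_ge_0|auto].
  - split; auto. rewrite Cmod_mult. apply Rmult_le_compat_r; [apply Cmod_ge_0|auto]. }
assert (B1 := bounded_variation (fun s : R => Re (f (x + s * h)%C))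
  (fun s => Re (df (x + s * h)%C * h)%C) (M * Cmod h) 0 1).
assert (B2 := bounded_variation (fun s : R => Im (f (x + s * h)%C))
  (fun s => Im (df (x + s * h)%C * h)%C) (M * Cmod h) 0 1).
cbv beta in B1, B2.
replace (x + 1 * h)%C with y in B1, B2 by (unfold h; ring).
replace (x + 0 * h)%C with x in B1, B2 by ring.
rewrite Rminus_0_r, Rabs_R1 in B1, B2.
apply Rle_trans with (1 := Cmod_le_abs _).
apply Rle_trans with (M * Cmod h * 1 + M * Cmod h * 1); [|lra].
apply Rplus_le_compat; [apply B1|apply B2]; intros s Hs'; rewrite Rminus_0_r in Hs'; destruct (Hs s Hs') as [K1 K2]; split.
- now apply has_cderiv_along_line.
- apply Rle_trans with (2 := K2). apply re_le_Cmod.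
- now apply has_cderiv_along_line.
- apply Rle_trans with (2 := K2). apply im_le_Cmod.
Qed.

Lemma has_cderiv_scal_l (c : C) (g : C -> C) (x l : C) :
  has_cderiv g x l -> has_cderiv (fun y => c * g y)%C x (c * l)%C.
Proof.
intros H. replace (c * l)%C with (0 * g x + c * l)%C by ring.
apply (has_cderiv_mult (fun _ => c) g); auto. apply has_cderiv_const.
Qed.

Lemma has_cderiv_id (x : C) : has_cderiv (fun y => y) x 1%C.
Proof.
apply has_cderiv_slope with (fun _ => 1%C).
- apply climit_const; ft.
- apply filter_forall. intros y. ring.
Qed.

(** * Neighbourhoods in C^n and integrals depending on a point *)

Definition nbCn {n : nat} (z : Cn n) : (Cn n -> Prop) -> Prop :=
  fun P => exists d, 0 < d /\ forall w : Cn n, (forall i, Cmod (w i - z i) < d) -> P w.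

Global Instance nbCn_filter {n : nat} (z : Cn n) : Filter (nbCn z).
Proof.
constructor.
- exists 1. split; [lra|]. auto.
- intros P Q [d [Hd HP]] [e [He HQ]]. exists (Rmin d e).
  split; [now apply Rmin_pos|].
  intros y Hy. pose proof (Rmin_l d e). pose proof (Rmin_r d e).
  split; [apply HP|apply HQ]; intros i; specialize (Hy i); lra.
- intros P Q H [d [Hd HP]]. exists d. split; auto.
Qed.

Lemma Cmod_diag (x : C) : Cmod (x - x) = 0.
Proof. replace (x - x)%C with (RtoC 0) by ring. apply Cmod_0. Qed.

Lemma nbCn_self {n : nat} (z : Cn n) (P : Cn n -> Prop) : nbCn z P -> P z.
Proof. intros [d [Hd H]]. apply H. intros i. now rewrite Cmod_diag. Qed.

Lemma filter_forall_fin {T : Type} (F : (T -> Prop) -> Prop) {FF : Filter F} (m : nat)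
  (P : Fin.t m -> T -> Prop) : (forall i, F (P i)) -> F (fun x => forall i, P i x).
Proof.
induction m as [|m IH]; intros H.
- apply filter_forall. intros x i. inversion i.
- assert (H1 := IH (fun i => P (Fin.FS i)) (fun i => H (Fin.FS i))).
  generalize (filter_and _ _ (H Fin.F1) H1). apply filter_imp.
  intros x [K1 K2] i. apply (Fin.caseS' i); auto.
Qed.

Lemma climit_coord {n : nat} (z : Cn n) (i : Fin.t n) : climit (nbCn z) (fun w => w i) (z i).
Proof. intros eps He. exists eps. auto. Qed.

Lemma polydisc_open {n : nat} (r : R) (z : Cn n) : polydisc r z -> nbCn z (polydisc r).
Proof.
intros Hz. apply (filter_forall_fin (nbCn z) n (fun i w => Cmod (w i) < r)). intros i.
assert (P : 0 < r - Cmod (z i)) by (specialize (Hz i); lra).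
generalize (climit_coord z i _ P). apply filter_imp. intros w Hw.
pose proof (Cmod_triangle (w i - z i) (z i)) as E.
replace (w i - z i + z i)%C with (w i) in E by ring. lra.
Qed.

Lemma upd_same {n : nat} (z : Cn n) (i : Fin.t n) (x : C) : upd z i x i = x.
Proof. unfold upd. destruct (Fin.eq_dec i i); congruence. Qed.

Lemma upd_other {n : nat} (z : Cn n) (i j : Fin.t n) (x : C) : i <> j -> upd z i x j = z j.
Proof. unfold upd. destruct (Fin.eq_dec i j); congruence. Qed.

Lemma upd_id {n : nat} (z : Cn n) (i : Fin.t n) : upd z i (z i) = z.
Proof. apply functional_extensionality. intros j. unfold upd. destruct (Fin.eq_dec i j); congruence. Qed.

Lemma upd_upd {n : nat} (z : Cn n) (i : Fin.t n) (x y : C) : upd (upd z i x) i y = upd z i y.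
Proof. apply functional_extensionality. intros j. unfold upd. destruct (Fin.eq_dec i j); congruence. Qed.

Lemma upd_comm {n : nat} (z : Cn n) (i j : Fin.t n) (x y : C) :
  i <> j -> upd (upd z i x) j y = upd (upd z j y) i x.
Proof.
intros N. apply functional_extensionality. intros k. unfold upd.
destruct (Fin.eq_dec i k), (Fin.eq_dec j k); congruence.
Qed.

Lemma polydisc_upd {n : nat} (r : R) (z : Cn n) (i : Fin.t n) (x : C) :
  polydisc r z -> Cmod x < r -> polydisc r (upd z i x).
Proof. intros Hz Hx j. unfold upd. destruct (Fin.eq_dec i j); auto. Qed.

Lemma polydisc_le {n : nat} (r s : R) (z : Cn n) : r <= s -> polydisc r z -> polydisc s z.
Proof. intros H Hz i. specialize (Hz i). lra. Qed.

Lemma nbCn_upd {n : nat} (z : Cn n) (j : Fin.t n) (P : Cn n -> Prop) :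
  nbCn z P -> nbC (z j) (fun x => P (upd z j x)).
Proof.
intros [d [Hd H]]. exists d. split; auto. intros x Hx. apply H. intros i.
unfold upd. destruct (Fin.eq_dec j i) as [->|N]; auto. now rewrite Cmod_diag.
Qed.

(** The tube lemma: compactness of [a, b] makes joint continuity at the points (z, t) uniform in t.
    Both G w s and G z s are compared with the value at a nearby centre (z, t), which splits eps in
    two. *)
Lemma param_tube {n : nat} (G : Cn n -> R -> C) (z : Cn n) (a b eps : R) :
  (forall t, a <= t <= b ->
     climit (filter_prod (nbCn z) (locally t)) (fun p => G (fst p) (snd p)) (G z t)) ->
  0 < eps -> nbCn z (fun w => forall t, a <= t <= b -> Cmod (G w t - G z t) < eps).
Proof.
intros H He.
assert (He2 : 0 < eps / 2) by lra.
assert (D : forall t, exists d : posreal, a <= t <= b -> forall w s,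
  (forall i, Cmod (w i - z i) < d) -> Rabs (s - t) < d -> Cmod (G w s - G z t) < eps / 2).
{ intros t. destruct (classic (a <= t <= b)) as [Ht|Ht].
  - destruct (H t Ht _ He2) as [Q1 Q2 [d1 [Hd1 K1]] [d2 K2] K].
    assert (Hd : 0 < Rmin d1 d2) by (apply Rmin_pos; [auto|apply cond_pos]).
    exists (mkposreal _ Hd). intros _ w s Hw Hs. simpl in Hw, Hs.
    pose proof (Rmin_l d1 d2). pose proof (Rmin_r d1 d2).
    apply (K w s).
    + apply K1. intros i. specialize (Hw i). lra.
    + apply K2. change (Rabs (s - t) < d2). lra.
  (* The radius function must be defined on all of R; outside [a, b] any positive value serves. *)
  - exists (mkposreal _ He2). tauto. }
set (delta := fun t => proj1_sig (constructive_indefinite_description _ (D t))).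
assert (Hdelta : forall t, a <= t <= b -> forall w s,
  (forall i, Cmod (w i - z i) < delta t) -> Rabs (s - t) < delta t -> Cmod (G w s - G z t) < eps / 2).
{ intros t. unfold delta. destruct (constructive_indefinite_description _ (D t)). auto. }
destruct (compactness_value_1d a b delta) as [d Hd].
exists d. split; [apply cond_pos|]. intros w Hw s Hs.
(* The compactness lemma states its conclusion under a double negation. *)
specialize (Hd s Hs). apply NNPP in Hd. destruct Hd as [t [Ht [Hst Hdt]]].
assert (K1 : Cmod (G w s - G z t) < eps / 2).
{ apply Hdelta; auto. intros i. apply Rlt_le_trans with (2 := Hdt). auto. }
assert (K2 : Cmod (G z s - G z t) < eps / 2).
{ apply Hdelta; auto. intros i. rewrite Cmod_diag. apply cond_pos. }
replace (G w s - G z s)%C with ((G w s - G z t) + (G z t - G z s))%C by ring.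
apply Rle_lt_trans with (1 := Cmod_triangle _ _). rewrite (Cmod_sub_sym (G z t)). lra.
Qed.

Lemma param_ccont_on {n : nat} (G : Cn n -> R -> C) (z : Cn n) (a b : R) :
  (forall t, a <= t <= b ->
     climit (filter_prod (nbCn z) (locally t)) (fun p => G (fst p) (snd p)) (G z t)) ->
  ccont_on (G z) a b.
Proof.
intros H t Ht eps He. destruct (H t Ht eps He) as [Q1 Q2 K1 K2 K].
generalize K2. apply filter_imp. intros s Hs. apply (K z s); auto. now apply nbCn_self.
Qed.

Lemma CInt_param_climit {n : nat} (G : Cn n -> R -> C) (z : Cn n) (a b : R) :
  a <= b -> nbCn z (fun w => ccont_on (G w) a b) ->
  (forall t, a <= t <= b ->
     climit (filter_prod (nbCn z) (locally t)) (fun p => G (fst p) (snd p)) (G z t)) ->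
  climit (nbCn z) (fun w => CInt (G w) a b) (CInt (G z) a b).
Proof.
intros Hab Hc H eps He.
assert (He' : 0 < eps / (2 * (b - a) + 1)) by (apply Rdiv_lt_0_compat; lra).
assert (T := param_tube G z a b _ H He').
generalize (filter_and _ _ Hc T). apply filter_imp. intros w [K1 K2].
assert (Cz := param_ccont_on G z a b H).
rewrite <- CInt_minus by auto.
apply Rle_lt_trans with (2 * (eps / (2 * (b - a) + 1)) * (b - a)).
- apply Cmod_CInt_le; auto.
  + intros t Ht. apply climit_minus; [ft|now apply K1|now apply Cz].
  + intros t Ht. left. auto.
- replace (2 * (eps / (2 * (b - a) + 1)) * (b - a)) with (eps * ((2 * (b - a)) / (2 * (b - a) + 1))) by (field; lra).
  rewrite <- (Rmult_1_r eps) at 2. apply Rmult_lt_compat_l; auto.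
  apply Rmult_lt_reg_r with (2 * (b - a) + 1); [lra|].
  unfold Rdiv. rewrite Rmult_assoc, Rinv_l; lra.
Qed.

(** Differentiation under the integral sign: the mean value inequality is applied to y -> G(y) -
    dG(z) y, whose derivative dG(y) - dG(z) is small uniformly in t by [param_tube]. *)
Lemma has_cderiv_CInt_param {n : nat} (G dG : Cn n -> R -> C) (z : Cn n) (j : Fin.t n) (a b : R) :
  a <= b ->
  nbCn z (fun w => ccont_on (G w) a b) ->
  nbCn z (fun w => forall t, a <= t <= b -> has_cderiv (fun y => G (upd w j y) t) (w j) (dG w t)) ->
  (forall t, a <= t <= b ->
     climit (filter_prod (nbCn z) (locally t)) (fun p => dG (fst p) (snd p)) (dG z t)) ->
  has_cderiv (fun y => CInt (G (upd z j y)) a b) (z j) (CInt (dG z) a b).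
Proof.
intros Hab Hc Hd H eps He.
(* 4 is the product of the factors 2 in [Cmod_CInt_le] and [has_cderiv_increment_le]; the + 1 covers
   a = b. *)
assert (He' : 0 < eps / (4 * (b - a) + 1)) by (apply Rdiv_lt_0_compat; lra).
set (eta := eps / (4 * (b - a) + 1)) in *.
assert (T := param_tube dG z a b _ H He').
assert (Cz := param_ccont_on dG z a b H).
assert (C0 := nbCn_self _ _ Hc). simpl in C0.
destruct (nbCn_upd z j _ (filter_and _ _ Hc (filter_and _ _ Hd T))) as [d [Hd0 K]].
exists d. split; auto. intros y Hy.
destruct (K y Hy) as [Cy _].
rewrite upd_id.
rewrite <- CInt_scal, <- !CInt_minus; auto.
2:{ intros t Ht. apply climit_minus; [ft|now apply Cy|now apply C0]. }
2:{ intros t Ht. apply climit_mult; [ft|apply climit_const; ft|now apply Cz]. }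
apply Rle_trans with (2 * (2 * eta * Cmod (y - z j)) * (b - a)).
- apply Cmod_CInt_le; auto.
  + intros t Ht. apply climit_minus; [ft|apply climit_minus; [ft|now apply Cy|now apply C0]|].
    apply climit_mult; [ft|apply climit_const; ft|now apply Cz].
  + intros t Ht.
    assert (M := has_cderiv_increment_le (fun x => G (upd z j x) t + (- dG z t) * x)%C
      (fun x => dG (upd z j x) t - dG z t)%C (z j) y eta).
    simpl in M. rewrite upd_id in M.
    replace (G (upd z j y) t - G z t - (y - z j) * dG z t)%C with
      (G (upd z j y) t + - dG z t * y - (G z t + - dG z t * z j))%C by ring.
    apply M. intros u Hu. destruct (K u) as [_ [K1 K2]]; [lra|]. split.
    * replace (dG (upd z j u) t - dG z t)%C with (dG (upd z j u) t + - dG z t * 1)%C by ring.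
      apply has_cderiv_plus.
      -- specialize (K1 t Ht). rewrite upd_same in K1.
         revert K1. apply has_cderiv_ext_loc. apply filter_forall. intros x. now rewrite upd_upd.
      -- apply has_cderiv_scal_l, has_cderiv_id.
    * left. auto.
- replace (2 * (2 * eta * Cmod (y - z j)) * (b - a)) with (eta * (4 * (b - a)) * Cmod (y - z j)) by ring.
  apply Rmult_le_compat_r; [apply Cmod_ge_0|].
  apply Rle_trans with (eta * (4 * (b - a) + 1)).
  + apply Rmult_le_compat_l; lra.
  + unfold eta. right. field. lra.
Qed.

Lemma holo_on_iff {n : nat} (r : R) (f : Cn n -> C) :
  holo_on r f <->
  (forall z, polydisc r z -> climit (nbCn z) f (f z)) /\
  (forall z, polydisc r z -> forall i, exists d, has_cderiv (fun w => f (upd z i w)) (z i) d).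
Proof.
unfold holo_on. split; intros [H1 H2]; split; intros z Hz.
- exact (H1 z Hz).
- intros i. destruct (H2 z Hz i) as [d Hd]. exists d. now apply is_derive_has_cderiv.
- exact (H1 z Hz).
- intros i. destruct (H2 z Hz i) as [d Hd]. exists d. now apply is_derive_has_cderiv.
Qed.

(** * Cauchy's formula in one coordinate *)

Section Partial.
Variables (n : nat) (r : R) (f : Cn n -> C).
Hypothesis Hf : holo_on r f.

(** The factor 1 fits the shape a - b x of [has_cderiv_inv_affine]. *)
Let u (rho : R) (t : R) (x : C) : C := (/ (rho * cis t - 1 * x))%C.
Let U (rho : R) (k : Fin.t n) (w : Cn n) (t : R) : Cn n := upd w k (rho * cis t)%C.

(* Cauchy's formula in the k-th variable, differentiated under the integral sign. *)
Definition cauchy_partial (rho : R) (k : Fin.t n) (z : Cn n) : C :=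
  (/ RtoC (2 * PI) * CInt (fun t => f (U rho k z t) * (rho * cis t * (u rho t (z k) * u rho t (z k)))) 0 (2 * PI))%C.

Lemma filterlim_upd_circle (rho : R) (k : Fin.t n) (z : Cn n) (t : R) :
  filterlim (fun p => U rho k (fst p) (snd p)) (filter_prod (nbCn z) (locally t)) (nbCn (U rho k z t)).
Proof.
intros P [d [Hd HP]].
assert (L : climit (locally t) (fun t => rho * cis t)%C (rho * cis t)%C) by clim.
apply Filter_prod with (fun w => forall i, Cmod (w i - z i) < d) (fun s => Cmod (rho * cis s - rho * cis t) < d).
- exists d. auto.
- exact (L d Hd).
- intros w s Hw Hs. apply HP. intros i. unfold U, upd; simpl. destruct (Fin.eq_dec k i); auto.
Qed.

Lemma climit_snd_cis {T : Type} (F : (T -> Prop) -> Prop) {FF : Filter F} (t : R) :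
  climit (filter_prod F (locally t)) (fun p => cis (snd p)) (cis t).
Proof. apply (climit_comp _ (locally t) snd cis); [apply filterlim_snd|apply climit_cis]. Qed.

Lemma u_sub_neq0 (rho : R) (t : R) (x : C) : Cmod x < rho -> (rho * cis t - 1 * x <> 0)%C.
Proof.
intros H. replace (1 * x)%C with x by ring. now apply circle_sub_neq0.
Qed.

Lemma climit_u (rho : R) (k : Fin.t n) (z : Cn n) (t : R) : Cmod (z k) < rho ->
  climit (filter_prod (nbCn z) (locally t)) (fun p => u rho (snd p) (fst p k)) (u rho t (z k)).
Proof.
intros H. unfold u. apply climit_inv; [ft|now apply u_sub_neq0|].
apply climit_minus; [ft| |]; apply climit_mult; try ft; try (apply climit_const; ft).
- apply climit_snd_cis; ft.
- apply (climit_comp _ (nbCn z) fst (fun w => w k)); [apply filterlim_fst|apply climit_coord].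
Qed.

(** h and Q stay open because the same shape of integrand recurs: h is f or again a Cauchy integral,
    and Q(ζ, u) is ζ u, ζ u^2 or the derivative of the latter. *)
Lemma climit_circle_kernel (h : Cn n -> C) (Q : C -> C -> C) (rho : R) (k : Fin.t n) (z : Cn n) (t : R) :
  climit (nbCn (U rho k z t)) h (h (U rho k z t)) ->
  climit (filter_prod (nbCn z) (locally t))
    (fun p => Q (rho * cis (snd p))%C (u rho (snd p) (fst p k))) (Q (rho * cis t)%C (u rho t (z k))) ->
  climit (filter_prod (nbCn z) (locally t))
    (fun p => h (U rho k (fst p) (snd p)) * Q (rho * cis (snd p)) (u rho (snd p) (fst p k)))%C
    (h (U rho k z t) * Q (rho * cis t) (u rho t (z k)))%C.
Proof.
intros Hh HQ. apply climit_mult; [ft| |auto].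
apply (climit_comp _ (nbCn (U rho k z t)) (fun p => U rho k (fst p) (snd p)) h); auto.
apply filterlim_upd_circle.
Qed.

(** The new coordinate has modulus exactly rho, so the point lies outside the polydisc of radius rho
    and a larger s is needed. *)
Lemma polydisc_circle (rho s : R) (k : Fin.t n) (z : Cn n) (t : R) :
  0 < rho -> rho < s -> polydisc rho z -> polydisc s (U rho k z t).
Proof.
intros H1 H2 Hz. apply polydisc_upd.
- apply polydisc_le with rho; auto; lra.
- rewrite Cmod_mult, Cmod_cis, Cmod_R, Rabs_pos_eq; lra.
Qed.

Lemma climit_kernel1 (rho : R) (k : Fin.t n) (z : Cn n) (t : R) : Cmod (z k) < rho ->
  climit (filter_prod (nbCn z) (locally t))
   (fun p => rho * cis (snd p) * u rho (snd p) (fst p k))%C (rho * cis t * u rho t (z k))%C.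
Proof.
intros H. apply climit_mult; [ft| |now apply climit_u].
apply climit_mult; [ft|apply climit_const; ft|apply climit_snd_cis; ft].
Qed.

Lemma climit_kernel2 (rho : R) (k : Fin.t n) (z : Cn n) (t : R) : Cmod (z k) < rho ->
  climit (filter_prod (nbCn z) (locally t))
   (fun p => rho * cis (snd p) * (u rho (snd p) (fst p k) * u rho (snd p) (fst p k)))%C
   (rho * cis t * (u rho t (z k) * u rho t (z k)))%C.
Proof.
intros H. apply climit_mult; [ft| |apply climit_mult; [ft|now apply climit_u|now apply climit_u]].
apply climit_mult; [ft|apply climit_const; ft|apply climit_snd_cis; ft].
Qed.

Lemma has_cderiv_u (rho t : R) (x : C) : Cmod x < rho ->
  has_cderiv (u rho t) x (u rho t x * u rho t x)%C.
Proof.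
intros H. assert (N := u_sub_neq0 rho t x H).
replace (u rho t x * u rho t x)%C with (1 / ((rho * cis t - 1 * x) * (rho * cis t - 1 * x)))%C
  by (unfold u; field; now rewrite Cmult_1_l in N).
now apply has_cderiv_inv_affine.
Qed.

Lemma kernel_nbhd_ccont (h : Cn n -> C) (Q : C -> C -> C) (rho s : R) (k : Fin.t n) (z : Cn n) :
  0 < rho -> rho < s -> polydisc rho z ->
  (forall w, polydisc s w -> climit (nbCn w) h (h w)) ->
  (forall w t, Cmod (w k) < rho -> climit (filter_prod (nbCn w) (locally t))
    (fun p => Q (rho * cis (snd p))%C (u rho (snd p) (fst p k))) (Q (rho * cis t)%C (u rho t (w k)))) ->
  nbCn z (fun w => ccont_on (fun t => h (U rho k w t) * Q (rho * cis t) (u rho t (w k)))%C 0 (2 * PI)).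
Proof.
intros H1 H2 Hz Hh HQ. generalize (polydisc_open rho z Hz). apply filter_imp. intros w Hw.
apply (param_ccont_on (fun w t => h (U rho k w t) * Q (rho * cis t) (u rho t (w k)))%C).
intros t _. apply climit_circle_kernel.
- apply Hh. now apply polydisc_circle.
- apply HQ. apply Hw.
Qed.

Lemma cauchy_partial_spec (rho : R) (k : Fin.t n) (z : Cn n) :
  0 < rho < r -> polydisc rho z ->
  climit (nbCn z) (cauchy_partial rho k) (cauchy_partial rho k z) /\
  has_cderiv (fun y => f (upd z k y)) (z k) (cauchy_partial rho k z).
Proof.
intros Hr Hz. assert (HPI := PI_RGT_0).
destruct (proj1 (holo_on_iff r f) Hf) as [Cf Df].
split.
- unfold cauchy_partial. apply climit_mult; [ft|apply climit_const; ft|].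
  apply (CInt_param_climit (fun w t => f (U rho k w t) * (rho * cis t * (u rho t (w k) * u rho t (w k))))%C); [lra| |].
  + apply (kernel_nbhd_ccont f (fun c v => c * (v * v))%C rho r); auto; try lra.
    intros w t Hw. now apply climit_kernel2.
  + intros t _. apply (climit_circle_kernel f (fun c v => c * (v * v))%C).
    * apply Cf. apply polydisc_circle; auto; lra.
    * apply climit_kernel2. apply Hz.
(* To be differentiated, the formula is needed at all points near z and not at z alone. *)
- assert (E : forall w, polydisc rho w ->
    f w = (/ RtoC (2 * PI) * CInt (fun t => f (U rho k w t) * (rho * cis t * u rho t (w k))) 0 (2 * PI))%C).
  { intros w Hw.
    assert (I := cauchy_integral_formula rho (w k) (fun y => f (upd w k y)) (Hw k)).
    simpl in I. rewrite upd_id in I. rewrite I.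
    - f_equal. apply CInt_ext; [lra|]. intros t _. unfold U, u. f_equal. f_equal. f_equal. ring.
    - intros x Hx. assert (Hu : polydisc r (upd w k x)).
      { apply polydisc_upd; [|lra]. apply polydisc_le with rho; auto; lra. }
      destruct (Df _ Hu k) as [l Hl]. rewrite upd_same in Hl. exists l. revert Hl.
      apply has_cderiv_ext_loc. apply filter_forall. intros y. now rewrite upd_upd. }
  assert (N := nbCn_upd z k _ (polydisc_open rho z Hz)).
  apply has_cderiv_ext_loc with (fun y => / RtoC (2 * PI) *
    CInt (fun t => f (U rho k (upd z k y) t) * (rho * cis t * u rho t (upd z k y k))) 0 (2 * PI))%C.
  { generalize N. apply filter_imp. intros y Hy. now rewrite <- E. }
  unfold cauchy_partial. apply has_cderiv_scal_l.
  apply (has_cderiv_CInt_param (fun w t => f (U rho k w t) * (rho * cis t * u rho t (w k)))%C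
    (fun w t => f (U rho k w t) * (rho * cis t * (u rho t (w k) * u rho t (w k))))%C); [lra| | |].
  + apply (kernel_nbhd_ccont f (fun c v => c * v)%C rho r); auto; try lra.
    intros w t Hw. now apply climit_kernel1.
  + generalize (polydisc_open rho z Hz). apply filter_imp. intros w Hw t _.
    apply has_cderiv_ext_loc with (fun y => f (U rho k w t) * (rho * cis t * u rho t y))%C.
    * apply filter_forall. intros y. unfold U. now rewrite upd_upd, upd_same.
    * do 2 apply has_cderiv_scal_l. apply has_cderiv_u. apply Hw.
  + intros t _. apply (climit_circle_kernel f (fun c v => c * (v * v))%C).
    * apply Cf. apply polydisc_circle; auto; lra.
    * apply climit_kernel2. apply Hz.
Qed.

(** For j = k only the kernel depends on the variable. Otherwise the kernel is constant and f is
    differentiated under the integral; the joint continuity of its j-th partial derivative that this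
    requires comes from [cauchy_partial_spec] in the variable j. *)
Lemma cauchy_partial_differentiable (rho : R) (k j : Fin.t n) (z : Cn n) :
  0 < rho < r -> polydisc rho z ->
  exists l, has_cderiv (fun y => cauchy_partial rho k (upd z j y)) (z j) l.
Proof.
intros Hr Hz. assert (HPI := PI_RGT_0).
destruct (proj1 (holo_on_iff r f) Hf) as [Cf Df].
assert (Hc : nbCn z (fun w => ccont_on (fun t => f (U rho k w t) * (rho * cis t * (u rho t (w k) * u rho t (w k))))%C 0 (2 * PI))).
{ apply (kernel_nbhd_ccont f (fun c v => c * (v * v))%C rho r); auto; try lra.
  intros w t Hw. now apply climit_kernel2. }
destruct (Fin.eq_dec j k) as [->|N].
- eexists. unfold cauchy_partial. apply has_cderiv_scal_l.
  apply (has_cderiv_CInt_param (fun w t => f (U rho k w t) * (rho * cis t * (u rho t (w k) * u rho t (w k))))%C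
    (fun w t => f (U rho k w t) * (rho * cis t *
      (u rho t (w k) * u rho t (w k) * u rho t (w k) + u rho t (w k) * (u rho t (w k) * u rho t (w k)))))%C); [lra|exact Hc| |].
  + generalize (polydisc_open rho z Hz). apply filter_imp. intros w Hw t _.
    apply has_cderiv_ext_loc with (fun y => f (U rho k w t) * (rho * cis t * (u rho t y * u rho t y)))%C.
    * apply filter_forall. intros y. unfold U. now rewrite upd_upd, upd_same.
    * do 2 apply has_cderiv_scal_l. apply has_cderiv_mult; apply has_cderiv_u; apply Hw.
  + intros t _. apply (climit_circle_kernel f (fun c v => c * (v * v * v + v * (v * v)))%C).
    * apply Cf. apply polydisc_circle; auto; lra.
    * assert (Lu := climit_u rho k z t (Hz k)).
      apply climit_mult; [ft|apply climit_mult; [ft|apply climit_const; ft|apply climit_snd_cis; ft]|].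
      apply climit_plus; [ft| |]; repeat (apply climit_mult; [ft| |]); auto.
(* The k-th coordinate runs over the circle of radius rho, so the j-th partial derivative must be
   represented on a polydisc of radius strictly between rho and r. *)
- set (s := (rho + r) / 2). assert (Hs : rho < s < r) by (unfold s; lra).
  eexists. unfold cauchy_partial. apply has_cderiv_scal_l.
  apply (has_cderiv_CInt_param (fun w t => f (U rho k w t) * (rho * cis t * (u rho t (w k) * u rho t (w k))))%C
    (fun w t => cauchy_partial s j (U rho k w t) * (rho * cis t * (u rho t (w k) * u rho t (w k))))%C); [lra|exact Hc| |].
  + generalize (polydisc_open rho z Hz). apply filter_imp. intros w Hw t _.
    apply has_cderiv_ext_loc with (fun y => (rho * cis t * (u rho t (w k) * u rho t (w k))) * f (upd (U rho k w t) j y))%C.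
    * apply filter_forall. intros y. unfold U. rewrite upd_other by auto.
      rewrite (upd_comm w j k) by auto. ring.
    * rewrite (Cmult_comm (cauchy_partial _ _ _)). apply has_cderiv_scal_l.
      replace (w j) with (U rho k w t j) by (unfold U; rewrite upd_other; auto).
      apply cauchy_partial_spec; [lra|]. apply polydisc_circle; auto; lra.
  + intros t _. apply (climit_circle_kernel (cauchy_partial s j) (fun c v => c * (v * v))%C).
    * apply cauchy_partial_spec; [lra|]. apply polydisc_circle; auto; lra.
    * apply climit_kernel2. apply Hz.
Qed.

Lemma holo_on_cauchy_partial (rho : R) (k : Fin.t n) :
  0 < rho < r -> holo_on rho (cauchy_partial rho k).
Proof.
intros Hr. apply holo_on_iff. split; intros z Hz.
- now apply cauchy_partial_spec.
- intros i. now apply cauchy_partial_differentiable.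
Qed.

End Partial.

Lemma holo_germ_partial {n : nat} (f : Cn n -> C) (k : Fin.t n) : holo_germ f ->
  exists D, holo_germ D /\ near0 (fun z => has_cderiv (fun y => f (upd z k y)) (z k) (D z)).
Proof.
intros [r [Hr Hf]]. exists (cauchy_partial n f (r / 2) k).
split; exists (r / 2); (split; [lra|]).
- apply holo_on_cauchy_partial with r; auto; lra.
- intros z Hz. apply cauchy_partial_spec with r; auto; lra.
Qed.

(** * Vector fields tangent to germs *)

Global Instance near0_filter {n : nat} : Filter (@near0 n).
Proof.
constructor.
- exists 1. split; [lra|]. auto.
- intros P Q [d [Hd HP]] [e [He HQ]]. exists (Rmin d e).
  split; [now apply Rmin_pos|]. intros z Hz.
  split; [apply HP|apply HQ]; apply polydisc_le with (2 := Hz); [apply Rmin_l|apply Rmin_r].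
- intros P Q H [d [Hd HP]]. exists d. split; auto.
Qed.

Lemma near0_at0 {n : nat} (P : Cn n -> Prop) : near0 P -> P (fun _ => 0%C).
Proof. intros [r [Hr H]]. apply H. intros i. now rewrite Cmod_0. Qed.

Lemma holo_on_le {n : nat} (r s : R) (f : Cn n -> C) : s <= r -> holo_on r f -> holo_on s f.
Proof.
intros H [H1 H2]. split; intros z Hz; [apply H1|apply H2]; now apply polydisc_le with s.
Qed.

Lemma holo_on_mult {n : nat} (r : R) (f g : Cn n -> C) :
  holo_on r f -> holo_on r g -> holo_on r (fun z => f z * g z)%C.
Proof.
rewrite !holo_on_iff. intros [H1 H2] [H3 H4]. split; intros z Hz.
- apply climit_mult; auto; ft.
- intros i. destruct (H2 z Hz i) as [d Hd], (H4 z Hz i) as [e He].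
  eexists. apply has_cderiv_mult; eauto.
Qed.

Lemma holo_on_plus {n : nat} (r : R) (f g : Cn n -> C) :
  holo_on r f -> holo_on r g -> holo_on r (fun z => f z + g z)%C.
Proof.
rewrite !holo_on_iff. intros [H1 H2] [H3 H4]. split; intros z Hz.
- apply climit_plus; auto; ft.
- intros i. destruct (H2 z Hz i) as [d Hd], (H4 z Hz i) as [e He].
  eexists. apply has_cderiv_plus; eauto.
Qed.

Lemma holo_germ_const {n : nat} (c : C) : holo_germ (fun _ : Cn n => c).
Proof.
exists 1. split; [lra|]. apply holo_on_iff. split; intros z Hz.
- apply climit_const; ft.
- intros i. exists 0%C. apply has_cderiv_const.
Qed.

Lemma holo_germ_mult {n : nat} (f g : Cn n -> C) :
  holo_germ f -> holo_germ g -> holo_germ (fun z => f z * g z)%C.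
Proof.
intros [r [Hr Hf]] [s [Hs Hg]]. exists (Rmin r s). split; [now apply Rmin_pos|].
apply holo_on_mult; [apply holo_on_le with (2 := Hf)|apply holo_on_le with (2 := Hg)];
  [apply Rmin_l|apply Rmin_r].
Qed.

Lemma holo_germ_plus {n : nat} (f g : Cn n -> C) :
  holo_germ f -> holo_germ g -> holo_germ (fun z => f z + g z)%C.
Proof.
intros [r [Hr Hf]] [s [Hs Hg]]. exists (Rmin r s). split; [now apply Rmin_pos|].
apply holo_on_plus; [apply holo_on_le with (2 := Hf)|apply holo_on_le with (2 := Hg)];
  [apply Rmin_l|apply Rmin_r].
Qed.

Lemma holo_germ_fsum {n : nat} (m : nat) (F : Fin.t m -> Cn n -> C) :
  (forall i, holo_germ (F i)) -> holo_germ (fun z => fsum m (fun i => F i z)).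
Proof.
induction m as [|m IH]; intros H; simpl; [apply holo_germ_const|].
apply (holo_germ_plus (F Fin.F1) (fun z => fsum m (fun i => F (Fin.FS i) z))); auto.
Qed.

Lemma fsum_scal (m : nat) (c : C) (a : Fin.t m -> C) :
  fsum m (fun i => c * a i)%C = (c * fsum m a)%C.
Proof.
induction m as [|m IH]; simpl; [ring|]. rewrite (IH (fun i => a (Fin.FS i))). ring.
Qed.

Definition vf_scal {n : nat} (h : Cn n -> C) (a : Fin.t n -> Cn n -> C) : Fin.t n -> Cn n -> C :=
  fun i z => (h z * a i z)%C.

Lemma vfield_scal {n : nat} (h : Cn n -> C) (a : Fin.t n -> Cn n -> C) :
  holo_germ h -> vfield a -> vfield (vf_scal h a).
Proof. intros Hh Ha i. apply holo_germ_mult; auto. Qed.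

Lemma vf_apply_at_scal {n : nat} (h : Cn n -> C) (a : Fin.t n -> Cn n -> C) (f : Cn n -> C) (z : Cn n) (v : C) :
  vf_apply_at a f z v -> vf_apply_at (vf_scal h a) f z (h z * v)%C.
Proof.
intros [d [Hd ->]]. exists d. split; auto. rewrite <- fsum_scal. f_equal.
apply functional_extensionality. intros i. unfold vf_scal. ring.
Qed.

Lemma vf_apply_at_unique {n : nat} (a : Fin.t n -> Cn n -> C) (f : Cn n -> C) (z : Cn n) (v w : C) :
  vf_apply_at a f z v -> vf_apply_at a f z w -> v = w.
Proof.
intros [d [Hd ->]] [e [He ->]]. do 2 f_equal. apply functional_extensionality. intros i.
f_equal. apply (has_cderiv_unique (fun w => f (upd z i w)) (z i)); now apply is_derive_has_cderiv.
Qed.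

(** This is what Cauchy's formula is for: D f is a holomorphic germ for every holomorphic f, not
    only for f in an ideal that D preserves. *)
Lemma vf_apply_germ {n : nat} (a : Fin.t n -> Cn n -> C) (f : Cn n -> C) :
  vfield a -> holo_germ f ->
  exists g, holo_germ g /\ near0 (fun z => vf_apply_at a f z (g z)).
Proof.
intros Ha Hf.
set (D k := proj1_sig (constructive_indefinite_description _ (holo_germ_partial f k Hf))).
assert (HD : forall k, holo_germ (D k) /\
  near0 (fun z => has_cderiv (fun y => f (upd z k y)) (z k) (D k z))).
{ intros k. unfold D. destruct (constructive_indefinite_description _ _). auto. }
exists (fun z => fsum n (fun i => a i z * D i z)%C). split.
- apply (holo_germ_fsum n (fun i z => a i z * D i z)%C). intros i.
  apply holo_germ_mult; [apply Ha|apply HD].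
- generalize (filter_forall_fin near0 n _ (fun i => proj2 (HD i))). apply (filter_imp (F := @near0 _)).
  intros z Hz. exists (fun i => D i z). split; auto. intros i. apply is_derive_has_cderiv. auto.
Qed.

(** * Germs and the functions vanishing on them *)

Definition vanishes {n : nat} (X : Cn n -> Prop) (f : Cn n -> C) : Prop :=
  near0 (fun z => X z -> f z = 0%C).

Definition germ_sub {n : nat} (X Y : Cn n -> Prop) : Prop := near0 (fun z => X z -> Y z).

Lemma germ_sub_trans {n : nat} (X Y Z : Cn n -> Prop) : germ_sub X Y -> germ_sub Y Z -> germ_sub X Z.
Proof.
intros H1 H2. generalize (filter_and (F := @near0 _) _ _ H1 H2). apply (filter_imp (F := @near0 _)). intros z [K1 K2]; auto.
Qed.

Lemma germ_eq_sub {n : nat} (X Y : Cn n -> Prop) : germ_eq X Y <-> germ_sub X Y /\ germ_sub Y X.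
Proof.
split.
- intros H. split; generalize H; apply (filter_imp (F := @near0 _)); intros z Hz; apply Hz.
- intros [H1 H2]. generalize (filter_and (F := @near0 _) _ _ H1 H2). apply (filter_imp (F := @near0 _)). intros z [K1 K2]; split; auto.
Qed.

Lemma vanishes_sub {n : nat} (X Y : Cn n -> Prop) (f : Cn n -> C) :
  germ_sub X Y -> vanishes Y f -> vanishes X f.
Proof.
intros H1 H2. generalize (filter_and (F := @near0 _) _ _ H1 H2). apply (filter_imp (F := @near0 _)). intros z [K1 K2]; auto.
Qed.

Lemma vanishes_mult_l {n : nat} (X : Cn n -> Prop) (f g : Cn n -> C) :
  vanishes X f -> vanishes X (fun z => f z * g z)%C.
Proof. apply (filter_imp (F := @near0 _)). intros z Hz Xz. rewrite Hz by auto. ring. Qed.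

Lemma vanishes_mult_r {n : nat} (X : Cn n -> Prop) (f g : Cn n -> C) :
  vanishes X g -> vanishes X (fun z => f z * g z)%C.
Proof. apply (filter_imp (F := @near0 _)). intros z Hz Xz. rewrite Hz by auto. ring. Qed.

Lemma analytic_germ_cut {n : nat} (X : Cn n -> Prop) (f : Cn n -> C) :
  analytic_germ X -> holo_germ f -> analytic_germ (fun z => X z /\ f z = 0%C).
Proof.
intros [r [fs [Hr [Hfs HX]]]] [s [Hs Hf]].
exists (Rmin r s), (f :: fs). split; [now apply Rmin_pos|]. split.
- intros g [<-|Hg].
  + apply holo_on_le with (2 := Hf), Rmin_r.
  + apply holo_on_le with r; [apply Rmin_l|auto].
- intros z Hz. rewrite (HX z) by (apply polydisc_le with (2 := Hz), Rmin_l).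
  split.
  + intros [H1 H2] g [<-|Hg]; auto.
  + intros H. split; [intros g Hg|]; apply H; simpl; auto.
Qed.

(** If f g vanishes on X, then X is the union of its parts where f = 0 and where g = 0;
    irreducibility makes X equal to one of them. *)
Lemma irreducible_prime {n : nat} (X : Cn n -> Prop) (f g : Cn n -> C) :
  irreducible_germ X -> holo_germ f -> holo_germ g ->
  vanishes X (fun z => f z * g z)%C -> vanishes X f \/ vanishes X g.
Proof.
intros [HX [_ Hirr]] Hf Hg H.
destruct (Hirr (fun z => X z /\ f z = 0%C) (fun z => X z /\ g z = 0%C)) as [E|E].
- now apply analytic_germ_cut.
- now apply analytic_germ_cut.
- generalize H. apply (filter_imp (F := @near0 _)). intros z Hz. split; [|tauto]. intros Xz.
  destruct (classic (f z = 0%C)) as [K|K]; [auto|].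
  destruct (classic (g z = 0%C)) as [K'|K']; [auto|].
  exfalso. exact (Cmult_neq_0 _ _ K K' (Hz Xz)).
- left. generalize E. apply (filter_imp (F := @near0 _)). tauto.
- right. generalize E. apply (filter_imp (F := @near0 _)). tauto.
Qed.

(** One of the finitely many equations defining X fails on Z: if all of them vanished on Z, they
    would do so on a common polydisc, and Z would lie in X. *)
Lemma germ_separation {n : nat} (X Z : Cn n -> Prop) :
  analytic_germ X -> ~ germ_sub Z X ->
  exists h, holo_germ h /\ vanishes X h /\ ~ vanishes Z h.
Proof.
intros [r [fs [Hr [Hfs HX]]]] N. apply NNPP. intros K. apply N.
assert (Hv : forall f, In f fs -> vanishes Z f).
{ intros f Hf. apply NNPP. intros Nf. apply K. exists f. split; [|split]; auto.
  - exists r. auto.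
  - exists r. split; auto. intros z Hz Xz. now apply (HX z Hz). }
assert (Hall : near0 (fun z => Z z -> forall f, In f fs -> f z = 0%C)).
{ clear - Hv. induction fs as [|f fs IH].
  - apply filter_forall. intros z _ f [].
  - assert (H1 := IH (fun g Hg => Hv g (or_intror Hg))).
    generalize (filter_and (F := @near0 _) _ _ (Hv f (or_introl eq_refl)) H1). apply (filter_imp (F := @near0 _)).
    intros z [K1 K2] Zz g [<-|Hg]; auto. }
assert (HX' : near0 (fun z => X z <-> forall f, In f fs -> f z = 0%C)) by (exists r; auto).
generalize (filter_and (F := @near0 _) _ _ Hall HX'). apply (filter_imp (F := @near0 _)). intros z [K1 K2] Zz. apply K2. auto.
Qed.

Lemma common_multiplier {n p : nat} (Xs : Fin.t p -> Cn n -> Prop) (Z : Cn n -> Prop) :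
  (forall i, analytic_germ (Xs i)) -> irreducible_germ Z ->
  exists h, holo_germ h /\ ~ vanishes Z h /\
    forall i, ~ germ_sub Z (Xs i) -> vanishes (Xs i) h.
Proof.
intros HX HZ. induction p as [|p IH].
- exists (fun _ => 1%C). split; [apply holo_germ_const|]. split.
  (* The empty product 1 does not vanish on Z because Z contains the origin. *)
  + intros H. apply near0_at0 in H. specialize (H (proj1 (proj2 HZ))). injection H. lra.
  + intros i. inversion i.
- destruct (IH (fun i => Xs (Fin.FS i))) as [h [H1 [H2 H3]]]; auto.
  destruct (classic (germ_sub Z (Xs Fin.F1))) as [S|S].
  + exists h. split; [|split]; auto. intros i. apply (Fin.caseS' i); auto. tauto.
  + destruct (germ_separation _ _ (HX Fin.F1) S) as [k [K1 [K2 K3]]].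
    exists (fun z => k z * h z)%C. split; [now apply holo_germ_mult|]. split.
    * intros V. destruct (irreducible_prime Z k h HZ K1 H1 V); auto.
    * intros i. apply (Fin.caseS' i).
      -- intros _. now apply vanishes_mult_l.
      -- intros j Hj. apply vanishes_mult_r. auto.
Qed.

Lemma tangent_scal {n : nat} (X : Cn n -> Prop) (h : Cn n -> C) (a : Fin.t n -> Cn n -> C) :
  holo_germ h -> tangent X a -> tangent X (vf_scal h a).
Proof.
intros Hh [Ha H]. split; [now apply vfield_scal|]. intros f Hf.
destruct (H f Hf) as [g [[G1 G2] G3]].
exists (fun z => h z * g z)%C. split; [split|].
- now apply holo_germ_mult.
- now apply vanishes_mult_r.
- generalize G3. apply (filter_imp (F := @near0 _)). intros z. apply vf_apply_at_scal.
Qed.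

Lemma tangent_scal_vanishes {n : nat} (X : Cn n -> Prop) (h : Cn n -> C) (a : Fin.t n -> Cn n -> C) :
  holo_germ h -> vanishes X h -> vfield a -> tangent X (vf_scal h a).
Proof.
intros Hh Hv Ha. split; [now apply vfield_scal|]. intros f [Hf _].
destruct (vf_apply_germ a f Ha Hf) as [g [G1 G2]].
exists (fun z => h z * g z)%C. split; [split|].
- now apply holo_germ_mult.
- now apply vanishes_mult_l.
- generalize G2. apply (filter_imp (F := @near0 _)). intros z. apply vf_apply_at_scal.
Qed.

Lemma tangent_scal_cancel {n : nat} (Z : Cn n -> Prop) (h : Cn n -> C) (a : Fin.t n -> Cn n -> C) :
  irreducible_germ Z -> holo_germ h -> ~ vanishes Z h -> vfield a ->
  tangent Z (vf_scal h a) -> tangent Z a.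
Proof.
intros HZ Hh Nh Ha [_ H]. split; auto. intros f Hf.
destruct (H f Hf) as [g' [[G1 G2] G3]].
destruct (vf_apply_germ a f Ha (proj1 Hf)) as [g [G4 G5]].
exists g. split; auto. split; auto.
(* What is left is that h g vanishes on Z. Near 0 it equals g', by uniqueness of partial
   derivatives, and g' is in I_Z. *)
destruct (irreducible_prime Z h g HZ Hh G4) as [K|K]; [|contradiction|exact K].
generalize (filter_and (F := @near0 _) _ _ (filter_and (F := @near0 _) _ _ G2 G3) G5). apply (filter_imp (F := @near0 _)).
intros z [[K1 K2] K3] Zz. rewrite <- K1 by auto.
apply (vf_apply_at_unique (vf_scal h a) f z); auto. now apply vf_apply_at_scal.
Qed.

Lemma tangent_germ_eq {n : nat} (X Y : Cn n -> Prop) (a : Fin.t n -> Cn n -> C) :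
  germ_eq X Y -> tangent X a -> tangent Y a.
Proof.
intros E [Ha H]. apply germ_eq_sub in E. destruct E as [E1 E2].
split; auto. intros f [F1 F2].
destruct (H f) as [g [[G1 G2] G3]].
- split; auto. now apply vanishes_sub with Y.
- exists g. split; auto. split; auto. now apply vanishes_sub with X.
Qed.

(** * Comparison of the two families *)

Lemma tangent_of_containing {n p : nat} (Xs : Fin.t p -> Cn n -> Prop) (Z : Cn n -> Prop) :
  (forall i, analytic_germ (Xs i)) -> irreducible_germ Z ->
  (forall a, tangent_family Xs (fun _ => True) a -> tangent Z a) ->
  forall a, tangent_family Xs (fun i => germ_sub Z (Xs i)) a -> tangent Z a.
Proof.
intros HX HZ H a [Ha Hta].
destruct (common_multiplier Xs Z HX HZ) as [h [H1 [H2 H3]]].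
apply tangent_scal_cancel with h; auto. apply H. split; [now apply vfield_scal|].
intros i _. destruct (classic (germ_sub Z (Xs i))) as [S|S].
- apply tangent_scal; auto.
- apply tangent_scal_vanishes; auto.
Qed.

(** The inductive step, kept asymmetric: it takes one inclusion of tangent fields, and the result
    for the members strictly above Y_j, as hypotheses, so that it applies with the families in
    either role. *)
Lemma irredundant_member_eq {n p r : nat} (Xs : Fin.t p -> Cn n -> Prop)
  (Ys : Fin.t r -> Cn n -> Prop) (j : Fin.t r) :
  (forall i, analytic_germ (Xs i)) -> irreducible_germ (Ys j) -> irredundant Ys ->
  (forall a, tangent_family Xs (fun _ => True) a -> tangent_family Ys (fun _ => True) a) ->
  (forall i, germ_sub (Ys j) (Xs i) -> ~ germ_sub (Xs i) (Ys j) -> exists k, germ_eq (Xs i) (Ys k)) ->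
  exists i, germ_eq (Ys j) (Xs i).
Proof.
intros HX HY Hirr HD Habove. apply NNPP. intros N. apply (Hirr j). intros a. split.
2:{ intros [Ha H]. split; auto. }
intros [Ha H]. split; auto. intros k _.
destruct (classic (k = j)) as [->|Hk]; auto.
apply (tangent_of_containing Xs); auto.
- intros b Hb. now apply (HD b Hb).
- split; auto. intros i Hi.
  (* Were X_i also contained in Y_j, the two would coincide, which [N] excludes; so the containment
     is strict. *)
  assert (Hi' : ~ germ_sub (Xs i) (Ys j)).
  { intros K. apply N. exists i. now apply germ_eq_sub. }
  destruct (Habove i Hi Hi') as [l Hl].
  apply tangent_germ_eq with (Ys l).
  + apply germ_eq_sub. apply germ_eq_sub in Hl. tauto.
  (* The copy of X_i among the Y_k is not Y_j itself, the containment being strict; it therefore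
     survives the removal of Y_j. *)
  + apply H. intros ->. apply Hi'. now apply germ_eq_sub in Hl.
Qed.

(** The list M covers the elements above x. On passing to some y above x, transitivity keeps
    everything above y inside M, and irreflexivity allows y to be dropped, so the length of M bounds
    the depth of the recursion. *)
Lemma finite_strict_induction {I : Type} (lt : I -> I -> Prop) (L : list I) (P : I -> Prop) :
  (forall x, ~ lt x x) -> (forall x y z, lt x y -> lt y z -> lt x z) -> (forall x, In x L) ->
  (forall x, (forall y, lt x y -> P y) -> P x) -> forall x, P x.
Proof.
intros Hirr Htrans HL Hstep.
assert (K : forall m (M : list I), (length M <= m)%nat -> forall x, (forall y, lt x y -> In y M) -> P x).
{ induction m as [|m IH]; intros M HM x Hx; apply Hstep; intros y Hy.
  - specialize (Hx y Hy). destruct M; [destruct Hx|simpl in HM; lia].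
  - destruct (in_split y M (Hx y Hy)) as [l1 [l2 ->]].
    rewrite length_app in HM; simpl in HM.
    apply (IH (l1 ++ l2)); [rewrite length_app; lia|].
    intros z Hz. specialize (Hx z (Htrans _ _ _ Hy Hz)).
    apply in_app_iff in Hx. apply in_app_iff.
    destruct Hx as [Hx|[<-|Hx]]; auto. destruct (Hirr _ Hz). }
intros x. apply (K (length L) L); auto.
Qed.

Lemma fin_enum (m : nat) : exists L : list (Fin.t m), forall i, In i L.
Proof.
induction m as [|m [L HL]].
- exists nil. intros i. inversion i.
- exists (Fin.F1 :: map Fin.FS L). intros i. apply (Fin.caseS' i); simpl; auto.
  intros j. right. now apply in_map.
Qed.

Theorem theorem1 (n p r : nat)
  (Xs : Fin.t p -> Cn n -> Prop) (Ys : Fin.t r -> Cn n -> Prop) :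
  (forall i, irreducible_germ (Xs i)) ->
  (forall j, irreducible_germ (Ys j)) ->
  irredundant Xs -> irredundant Ys ->
  (forall a, tangent_family Xs (fun _ => True) a <->
             tangent_family Ys (fun _ => True) a) ->
  (forall i, exists j, germ_eq (Xs i) (Ys j)) /\
  (forall j, exists i, germ_eq (Ys j) (Xs i)).
Proof.
intros HX HY IX IY HD.
(* Matching Y_j needs the larger X_i to be matched already, and matching those needs larger Y_k in
   turn; hence a single induction over the disjoint union of the index sets. *)
set (Z := fun x : Fin.t p + Fin.t r => match x with inl i => Xs i | inr j => Ys j end).
set (P := fun x : Fin.t p + Fin.t r => match x with
  | inl i => exists j, germ_eq (Xs i) (Ys j)
  | inr j => exists i, germ_eq (Ys j) (Xs i) end).
destruct (fin_enum p) as [L1 H1]. destruct (fin_enum r) as [L2 H2].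
assert (H : forall x, P x).
{ apply (finite_strict_induction
    (fun x y => germ_sub (Z x) (Z y) /\ ~ germ_sub (Z y) (Z x)) (map inl L1 ++ map inr L2)).
  - tauto.
  - intros x y z [K1 K2] [K3 K4]. split.
    + now apply germ_sub_trans with (Z y).
    + intros K. apply K4. now apply germ_sub_trans with (Z x).
  - intros [i|j]; apply in_app_iff; [left|right]; now apply in_map.
  - intros [i|j] IH; simpl.
    + apply irredundant_member_eq; auto.
      * intros j. apply HY.
      * intros a. apply HD.
      * intros j K1 K2. exact (IH (inr j) (conj K1 K2)).
    + apply irredundant_member_eq; auto.
      * intros i. apply HX.
      * intros a. apply HD.
      * intros i K1 K2. exact (IH (inl i) (conj K1 K2)). }
split; [intros i; exact (H (inl i))|intros j; exact (H (inr j))].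
Qed.
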